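(* Let $a\in(0,1]$, $C>0$ and $\delta\in[0,\tfrac12)$. Let $f:\mathbb{T}^2\to\mathbb{T}^2$ be an area-preserving irrational pseudo-rotation which is Hölder continuous with exponent $a$, and let $\overline{\omega}=\rho(f)\in\mathbb{T}^2$ be its (irrational) rotation vector. Suppose that $$\liminf_{n\to\infty} n^{-1}a^{n}\ln\lVert n\overline{\omega}\rVert_{\mathbb{T}^2}=-\infty$$ and that $f$ has $(C,\delta)$-deviation. Then $f$ is $C^0$-rigid with exponential rate.
   Context: $\mathbb{T}^2=\mathbb{R}^2/\mathbb{Z}^2$, $\pi:\mathbb{R}^2\to\mathbb{T}^2$ is the covering projection, $|\cdot|$ is the Euclidean norm, and for $x\in\mathbb{R}^2$, $\|x\|_{\mathbb{T}^2}=\min_{y\in\mathbb{Z}^2}|x-y|$; this descends to $\mathbb{T}^2$ and $d(z,z')=\|z-z'\|_{\mathbb{T}^2}$ is the metric. Area-preserving means preserving the Lebesgue probability measure on $\mathbb{T}^2$. A map $f$ is Hölder with exponent $a$ if $d(f(x),f(y))\le M\,d(x,y)^a$ for some $M<\infty$ and all $x,y$. Let $f$ be a homeomorphism of $\mathbb{T}^2$ isotopic to the identity and $\tilde f:\mathbb{R}^2\to\mathbb{R}^2$ a lift ($\pi\circ\tilde f=f\circ\pi$). The rotation set $\rho(\tilde f)$ is the set of $v\in\mathbb{R}^2$ for which there are $\tilde z_i\in\mathbb{R}^2$ and $n_i\to\infty$ with $(\tilde f^{n_i}(\tilde z_i)-\tilde z_i)/n_i\to v$. If $\rho(\tilde f)$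 is a singleton, $f$ is called a pseudo-rotation, $\rho(\tilde f)$ is identified with its unique element, and $\rho(f)=\rho(\tilde f)\bmod\mathbb{Z}^2$ (independent of the lift). The pseudo-rotation is irrational if $\rho(\tilde f)\in\mathbb{R}^2\setminus\mathbb{Q}^2$. For a pseudo-rotation $f$, $n\ge1$, $z\in\mathbb{T}^2$ and any $\tilde z\in\pi^{-1}(z)$, put $\Delta_n(f,z)=\left|\frac{\tilde f^n(\tilde z)-\tilde z}{n}-\rho(\tilde f)\right|$ (independent of the choice of lifts), and $\Delta_N(f)=\sup_{n\ge N}\max_{z\in\mathbb{T}^2}\Delta_n(f,z)$. $f$ has $(C,\delta)$-deviation if $\Delta_N(f)\le C N^{\delta-1}$ for all integers $N\ge1$. $d_{C^0}(f,g)=\max_{z}d(f(z),g(z))$. $f$ is $C^0$-rigid with exponential rate if there are a strictly increasing sequence of positive integers $(n_j)$ and constants $C_1,C_2>0$ with $d_{C^0}(f^{n_j},\mathrm{id})\le C_1e^{-C_2n_j}$ for all $j$. *)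

(* Defs.v *)
From HB Require Import structures.
From mathcomp Require Import all_boot all_order all_algebra.
From mathcomp Require Import generic_quotient ring_quotient.
From mathcomp Require Import all_classical all_reals all_analysis.
Import Order.TTheory GRing.Theory Num.Theory.
Import numFieldNormedType.Exports.

Set Implicit Arguments.
Unset Strict Implicit.
Unset Printing Implicit Defensive.

Local Open Scope classical_set_scope.
Local Open Scope ring_scope.
Local Open Scope quotient_scope.

(* R * R carries the product topology and vector space structure; its library
   norm is the sup norm, so the Euclidean norm is defined separately.         *)

Definition Z2 (R : realType) : {pred R * R} :=
  fun x => (x.1 \is a Num.int) && (x.2 \is a Num.int).
Arguments Z2 : clear implicits.

Lemma Z2_zmod_closed (R : realType) : zmod_closed (Z2 R).
Proof.
split=> [|x y]; first by apply/andP; split; exact: rpred0.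
by move=> /andP[x1 x2] /andP[y1 y2]; apply/andP; split; exact: rpredB.
Qed.

HB.instance Definition _ (R : realType) :=
  GRing.isZmodClosed.Build (R * R)%type (Z2 R) (@Z2_zmod_closed R).

Definition T2 (R : realType) : Type := quotient_topology (Quotient.quot (Z2 R)).

HB.instance Definition _ (R : realType) :=
  Topological.copy (T2 R) (quotient_topology (Quotient.quot (Z2 R))).
HB.instance Definition _ (R : realType) :=
  Quotient.copy (T2 R) (quotient_topology (Quotient.quot (Z2 R))).
HB.instance Definition _ (R : realType) :=
  GRing.Zmodule.copy (T2 R) (Quotient.quot (Z2 R)).

Definition pi_T2 (R : realType) (x : R * R) : T2 R := \pi_(T2 R) x.

Section torus.
Context {R : realType}.
Implicit Types (x y v : R * R) (z w : T2 R) (f g : T2 R -> T2 R)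
  (ft : R * R -> R * R).

Lemma pi_T2D x y : pi_T2 (x + y) = pi_T2 x + pi_T2 y.
Proof. exact: (@Quotient.pi_add _ (Z2 R)). Qed.

Lemma pi_T2B x y : pi_T2 (x - y) = pi_T2 x - pi_T2 y.
Proof.
rewrite pi_T2D; congr (_ + _).
exact: (@Quotient.pi_opp _ (Z2 R)).
Qed.

Lemma pi_T2_eq x y : pi_T2 x = pi_T2 y <-> x - y \in Z2 R.
Proof.
have -> := Quotient.idealrBE (Z2 R) x y.
by split=> [h|/eqP //]; apply/eqP; exact: h.
Qed.

Lemma pi_T2_continuous : continuous (@pi_T2 R).
Proof. exact: pi_continuous. Qed.

Definition enorm x : R := Num.sqrt (x.1 ^+ 2 + x.2 ^+ 2).

(* The infimum is attained, so it is the minimum over the lattice. *)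
Definition plane_tnorm x : R := inf [set enorm (x - y) | y in [set` Z2 R]].

Definition tnorm z : R := plane_tnorm (repr z).

Lemma tnorm_pi_T2 x : tnorm (pi_T2 x) = plane_tnorm x.
Proof.
rewrite /tnorm /plane_tnorm; congr inf.
have kZ : repr (pi_T2 x) - x \in Z2 R by apply/pi_T2_eq; rewrite /pi_T2 reprK.
apply/seteqP; split=> _ [y /= yZ <-].
- exists (y - (repr (pi_T2 x) - x)); first by rewrite /= rpredB.
  by rewrite opprB addrA [x + _]addrC subrK.
- exists (y + (repr (pi_T2 x) - x)); first by rewrite /= rpredD.
  by rewrite opprD opprB addrCA [_ + (x - _)]addrC subrK addrC.
Qed.

Definition tdist z w : R := tnorm (z - w).

Definition borel_T2 : set (set (T2 R)) := <<s [set U : set (T2 R) | open U] >>.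

(* Lebesgue probability measure, computed on the fundamental domain. *)
Definition area (A : set (T2 R)) : \bar R :=
  (lebesgue_measure \x lebesgue_measure)%E
    (@pi_T2 R @^-1` A `&` (`[0, 1[ `*` `[0, 1[)).

Definition area_preserving f :=
  forall A, borel_T2 A -> area (f @^-1` A) = area A.

Definition holder (a : R) f :=
  exists M : R, forall z w, tdist (f z) (f w) <= M * tdist z w `^ a.

Definition homeomorphism f :=
  continuous f /\ exists g, [/\ continuous g, cancel f g & cancel g f].

Definition isotopic_to_id f :=
  exists H : R -> T2 R -> T2 R,
    [/\ {within `[0, 1] `*` [set: T2 R], continuous (fun p => H p.1 p.2)},
        forall t, t \in `[0, 1] -> homeomorphism (H t),
        H 0 = id & H 1 = f].

Definition is_lift f ft := continuous ft /\ (forall x, pi_T2 (ft x) = f (pi_T2 x)).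

Definition rotation_set ft : set (R * R) :=
  [set v | exists (x_ : nat -> R * R) (n_ : nat -> nat),
     n_ @ \oo --> \oo /\
     (n_ i)%:R^-1 *: (iter (n_ i) ft (x_ i) - x_ i) @[i --> \oo] --> v].

(* The lift and the rotation vector are carried along as parameters: f is a
   pseudo-rotation when this holds for some ft and v. *)
Definition pseudo_rotation f ft v :=
  [/\ homeomorphism f, isotopic_to_id f, is_lift f ft &
      rotation_set ft = [set v]].

Definition rational_vector v := rational v.1 /\ rational v.2.

Definition irrational_pseudo_rotation f ft v :=
  pseudo_rotation f ft v /\ ~ rational_vector v.

(* For ft, v as in pseudo_rotation the value does not depend on the chosen
   preimage of z. *)
Definition Delta_at ft v (n : nat) z : R :=
  enorm (n%:R^-1 *: (iter n ft (repr z) - repr z) - v).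

Definition Delta ft v (N : nat) : \bar R :=
  ereal_sup [set ereal_sup [set (Delta_at ft v n z)%:E | z in [set: T2 R]]
            | n in [set n | (N <= n)%N]].

Definition has_deviation ft v (C delta : R) :=
  forall N : nat, (1 <= N)%N ->
    (Delta ft v N <= (C * N%:R `^ (delta - 1))%:E)%E.

(* The torus has finite diameter, so this is a supremum of a bounded set. *)
Definition dC0 f g : R := sup [set tdist (f z) (g z) | z in [set: T2 R]].

Definition C0_rigid_exp f :=
  exists (n_ : nat -> nat) (C1 C2 : R),
    [/\ {homo n_ : i j / (i < j)%N >-> (i < j)%N}, forall j, (0 < n_ j)%N,
        0 < C1, 0 < C2 &
        forall j, dC0 (iter (n_ j) f) id <= C1 * expR (- C2 * (n_ j)%:R)].

End torus.

(* Main.v *)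
Require Import Defs.
From mathcomp Require Import all_boot all_order all_algebra.
From mathcomp Require Import all_classical all_reals all_analysis.
From mathcomp Require Import ring lra zify.
Import Order.TTheory GRing.Theory Num.Theory.
Import numFieldNormedType.Exports.

Set Implicit Arguments.
Unset Strict Implicit.
Unset Printing Implicit Defensive.

Local Open Scope classical_set_scope.
Local Open Scope ring_scope.

(** The liminf hypothesis provides infinitely many times q at which q v is
    within eps of an integer vector p, where eps is so small that
    a^q ln (1 / eps) exceeds any prescribed multiple of q.  At such a time the
    map g = ft^q - p is a lift of f^q whose mean displacement is at most of
    order eps, and it is shown that g moves no point by more than exp (- q)
    ([near_return_displacement]).

    Suppose that g moves z further than that.  Iterating the Holder estimate
    upstairs ([holder_lift_iter]), the square B of half-side
    s = exp (- L q / a^q) about z is still disjoint from g (B), for a constant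
    L.  Two facts then contradict each other.

    - Topology.  A fixed point of g would be a point with rational rotation
      vector, so g has none.  By Brouwer's lemma for plane homeomorphisms
      without fixed point, a disc disjoint from its image is disjoint from all
      its later images: g^k (B) never meets B ([free_square_wandering]).

    - Measure.  Up to time m = 1 / eps the deviation bound confines
      g^i (x) - x to a box of size D, of order (m q)^delta.  If B never returns
      to itself, the m preimages of its projection, all of area at least s^2,
      cover every point of the torus at most (2 D + 7)^2 times, once for each
      admissible lattice translation; hence m s^2 <= (2 D + 7)^2
      ([square_recurrence]).  As 2 delta < 1 this bounds m by a power of 1 / s,
      that is, a^q ln (1 / eps) by a multiple of q ([recurrence_rate]).

    Brouwer's lemma is proved here by comparing the turning of nowhere zero
    periodic planar vector fields ([same_turn]), without any separation
    theorem.  Growing the square until it touches its image yields a point y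
    such that y and g (y) both lie in the closed square; a broken line from y
    to g (y) through the square and its images form a chain.  At the first
    return, a push supported in the square closes this chain up: there is a
    loop c of period n, made of n successive images of one arc, whose points at
    parameter distance between 1 and n - 1 are distinct, and which the pushed
    map h shifts by one unit of time except along the last arc.  Put E = h c and
    e (t) = c (t + 1).  Since E and e differ only on an interval of length 1,

      (E (t + 1) - E (t)) (e (t + 1) - e (t))
        = (E (t + 1) - e (t)) (e (t + 1) - E (t))

    as complex numbers.  Both factors on the left turn like
    c (t + n / 2) - c (t), which changes sign over half a period and hence makes
    an odd number of turns.  Both factors on the right turn like h c - c, which
    would not turn at all if h had no fixed point, since c can be contracted to
    a point ([closed_chain_fixed_point]). *)

(** * Clopen conditions on the unit interval *)

Section winding.
Context {R : realType}.
Implicit Types (T : R) (F G H : R -> R * R) (z w : R * R).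

(** Connectedness of the unit interval in the form used for continuity
    methods: a condition that is locally constant propagates from 0 to 1. *)
Lemma unit_interval_chain (Q : R -> Prop) :
  (forall t : R, 0 <= t <= 1 -> \forall s \near t, 0 <= s <= 1 -> (Q s <-> Q t)) ->
  Q 0 -> Q 1.
Proof.
move=> loc Q0; pose B := [set t : R | 0 <= t <= 1 /\ Q t].
have itvE : [set` `[0%R, 1%R]] = [set t : R | 0 <= t <= 1].
  by apply/seteqP; split=> t /=; rewrite in_itv.
suff BE : B = [set` `[0%R, 1%R]] by have [] : B 1 by rewrite BE /= in_itv /= ler01 lexx.
have clop (P : R -> Prop) : (forall t : R, 0 <= t <= 1 ->
    \forall s \near t, 0 <= s <= 1 -> (P s <-> P t)) ->
    exists2 U : set R, open U &
      [set t : R | 0 <= t <= 1 /\ P t] = [set` `[0%R, 1%R]] `&` U.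
  move=> Ploc; exists (interior [set t : R | 0 <= t <= 1 -> P t]).
    exact: open_interior.
  rewrite itvE; apply/seteqP; split=> t /= [t01 Pt]; split=> //.
    have := Ploc _ t01; rewrite /interior; apply: filterS => s + s01.
    by move=> /(_ s01) [_]; exact.
  by have /= := nbhs_singleton Pt; exact.
apply: segment_connected.
- by exists 0; rewrite /B /= lexx ler01.
- exact: clop.
- have [|U oU UE] := clop (fun t => ~ Q t).
    move=> t t01; have := loc _ t01; apply: filterS => s + s01.
    by move=> /(_ s01) [a b]; split; apply: contra_not.
  exists (~` U); first exact: open_closedC.
  apply/seteqP; split=> t.
    move=> [t01 Qt]; split; first by rewrite itvE.
    move=> Ut; have : ([set` `[0%R, 1%R]] `&` U) t by split; rewrite ?itvE.
    by rewrite -UE => -[_]; exact.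
  rewrite itvE => -[t01 nU]; split=> //; apply: contrapT => nQ.
  have : [set t | 0 <= t <= 1 /\ ~ Q t] t by [].
  by rewrite UE => -[].
Qed.

End winding.

(** * Continuity rules *)

Section continuity_rules.
Context {R : realType} {X : topologicalType}.
Implicit Types (u v : X -> R) (V : normedModType R).

Lemma cont_cst (Y : topologicalType) (y : Y) : continuous (fun _ : X => y).
Proof. by move=> x; exact: cvg_cst. Qed.
Lemma cont_id : continuous (fun x : X => x).
Proof. by move=> x; exact: cvg_id. Qed.
Lemma cont_comp (Y Z : topologicalType) (g : Y -> Z) (f : X -> Y) :
  continuous g -> continuous f -> continuous (fun x => g (f x)).
Proof. by move=> cg cf x; apply: (@continuous_comp _ _ _ f g); [exact: cf|exact: cg]. Qed.
Lemma cont_mul u v : continuous u -> continuous v ->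
  continuous (fun x => u x * v x).
Proof. by move=> cu cv x; exact: (cvgM (cu x) (cv x)). Qed.
Lemma cont_inv u : (forall x, u x != 0) -> continuous u ->
  continuous (fun x => (u x)^-1).
Proof. by move=> u0 cu x; exact: (cvgV (u0 x) (cu x)). Qed.
Lemma cont_add V (f g : X -> V) : continuous f -> continuous g ->
  continuous (fun x => f x + g x).
Proof. by move=> cf cg x; exact: (cvgD (cf x) (cg x)). Qed.
Lemma cont_opp V (f : X -> V) : continuous f -> continuous (fun x => - f x).
Proof. by move=> cf x; exact: (cvgN (cf x)). Qed.
Lemma cont_scale V u (f : X -> V) : continuous u -> continuous f ->
  continuous (fun x => u x *: f x).
Proof. by move=> cu cf x; exact: (cvgZ (cu x) (cf x)). Qed.
Lemma cont_norm V (f : X -> V) : continuous f -> continuous (fun x => `|f x|).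
Proof. by move=> cf x; exact: (cvg_norm (cf x)). Qed.
Lemma cont_max u v : continuous u -> continuous v ->
  continuous (fun x => Num.max (u x) (v x)).
Proof. by move=> cu cv x; exact: (continuous_max (cu x) (cv x)). Qed.
Lemma cont_min u v : continuous u -> continuous v ->
  continuous (fun x => Num.min (u x) (v x)).
Proof. by move=> cu cv x; exact: (continuous_min (cu x) (cv x)). Qed.
Lemma cont_pair (Y Z : topologicalType) (f : X -> Y) (g : X -> Z) :
  continuous f -> continuous g -> continuous (fun x => (f x, g x)).
Proof. by move=> cf cg x; exact: (cvg_pair (cf x) (cg x)). Qed.
Lemma cont_fst (Y Z : topologicalType) (f : X -> Y * Z) :
  continuous f -> continuous (fun x => (f x).1).
Proof. by move=> cf; apply: (cont_comp _ cf) => -[y z]; exact: cvg_fst. Qed.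
Lemma cont_snd (Y Z : topologicalType) (f : X -> Y * Z) :
  continuous f -> continuous (fun x => (f x).2).
Proof. by move=> cf; apply: (cont_comp _ cf) => -[y z]; exact: cvg_snd. Qed.
End continuity_rules.

Ltac continuity_step :=
  lazymatch goal with
  | |- continuous (fun _ => ?y) => exact: cont_cst
  | |- continuous (fun x => x) => exact: cont_id
  | |- continuous (fun x => (@?f x, @?g x)) => apply: (@cont_pair _ _ _ f g)
  | |- continuous (fun x => (@?f x) + (@?g x)) => apply: (@cont_add _ _ _ f g)
  | |- continuous (fun x => - (@?f x)) => apply: (@cont_opp _ _ _ f)
  | |- continuous (fun x => (@?f x) * (@?g x)) => apply: (@cont_mul _ _ f g)
  | |- continuous (fun x => (@?f x) *: (@?g x)) => apply: (@cont_scale _ _ _ f g)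
  | |- continuous (fun x => `|@?f x|) => apply: (@cont_norm _ _ _ f)
  | |- continuous (fun x => Num.max (@?f x) (@?g x)) => apply: (@cont_max _ _ f g)
  | |- continuous (fun x => Num.min (@?f x) (@?g x)) => apply: (@cont_min _ _ f g)
  | |- continuous (fun x => cos (@?f x)) =>
      apply: (@cont_comp _ _ _ _ f (@continuous_cos _))
  | |- continuous (fun x => sin (@?f x)) =>
      apply: (@cont_comp _ _ _ _ f (@continuous_sin _))
  | |- continuous (fun x => atan (@?f x)) =>
      apply: (@cont_comp _ _ _ _ f (@continuous_atan _))
  | |- continuous (fun x => (@?f x).1) => apply: (@cont_fst _ _ _ f)
  | |- continuous (fun x => (@?f x).2) => apply: (@cont_snd _ _ _ f)
  | |- continuous fst => exact: (cont_fst (@cont_id _))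
  | |- continuous snd => exact: (cont_snd (@cont_id _))
  | H : continuous ?g |- continuous (fun x => ?g (@?f x)) =>
      apply: (@cont_comp _ _ _ g f H)
  end.
Ltac continuity := repeat first [assumption | continuity_step].

(** * Turning of periodic planar vector fields *)

Section turning.
Context {R : realType}.
Implicit Types (T : R) (F G H : R -> R * R) (z w : R * R).

Lemma plane_eq z w : z.1 = w.1 -> z.2 = w.2 -> z = w.
Proof. by case: z w => [a b] [c d] /= -> ->. Qed.

Definition cmul z w : R * R := (z.1 * w.1 - z.2 * w.2, z.1 * w.2 + z.2 * w.1).
Definition cis (t : R) : R * R := (cos t, sin t).
Definition dotp z w : R := z.1 * w.1 + z.2 * w.2.

(** [same_turn T F G] says that the loops F and G of period T have the same
    winding number around the origin, in the form that G is F rotated by a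
    continuous T-periodic angle and rescaled.  This avoids angle lifts of F and
    of G themselves: the relation is an equivalence compatible with complex
    multiplication, and that is all the index arguments below need. *)
Definition same_turn T F G := exists th : R -> R,
  [/\ continuous th, forall t, th (t + T) = th t &
      forall t, exists2 r : R, 0 < r & G t = r *: cmul (cis (th t)) (F t)].

Lemma cis_norm t : cos t ^+ 2 + sin t ^+ 2 = 1 :> R.
Proof. exact: cos2Dsin2. Qed.

Lemma same_turn_refl T F : same_turn T F F.
Proof.
exists (fun=> 0); split=> //; first exact: cont_cst.
move=> t; exists 1 => //; rewrite /cmul /cis cos0 sin0 /=.
by apply: plane_eq; rewrite /= scale1r; ring.
Qed.

Lemma same_turn_scale T F (r : R -> R) : (forall t, 0 < r t) ->
  same_turn T F (fun t => r t *: F t).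
Proof.
move=> r0; have [th [cth pth E]] := same_turn_refl T F.
exists th; split=> // t; have [s s0 Fs] := E t.
by exists (r t * s); rewrite ?mulr_gt0// {1}Fs scalerA.
Qed.

Lemma same_turn_sym T F G : same_turn T F G -> same_turn T G F.
Proof.
move=> [th [cth pth E]]; exists (fun t => - th t); split.
- by continuity.
- by move=> t; rewrite pth.
move=> t; have [r r0 ->] := E t; exists r^-1; first by rewrite invr_gt0.
rewrite /cmul /cis cosN sinN /=.
have n := cis_norm (th t).
have {n} n1 : sin (th t) ^+ 2 = 1 - cos (th t) ^+ 2 by rewrite -n; ring.
have rV := mulVf (lt0r_neq0 r0).
apply: plane_eq; rewrite /=;
  rewrite /GRing.scale /=; field: n1; exact: lt0r_neq0.
Qed.

Lemma same_turn_mul T F F' G G' : same_turn T F G -> same_turn T F' G' ->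
  same_turn T (fun t => cmul (F t) (F' t)) (fun t => cmul (G t) (G' t)).
Proof.
move=> [th [cth pth E]] [th' [cth' pth' E']].
exists (fun t => th t + th' t); split.
- by continuity.
- by move=> t; rewrite pth pth'.
move=> t; have [r r0 ->] := E t; have [r' r'0 ->] := E' t.
exists (r * r'); first exact: mulr_gt0.
rewrite /cmul /cis cosD sinD /= /GRing.scale /=.
by apply: plane_eq; rewrite /= /GRing.scale /=; ring.
Qed.

Lemma same_turn_trans T F G H : same_turn T F G -> same_turn T G H ->
  same_turn T F H.
Proof.
move=> [th [cth pth E]] [th' [cth' pth' E']].
exists (fun t => th t + th' t); split.
- by continuity.
- by move=> t; rewrite pth pth'.
move=> t; have [r r0 rE] := E t; have [r' r'0 ->] := E' t.
exists (r * r'); first exact: mulr_gt0.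
rewrite rE /cmul /cis cosD sinD /= /GRing.scale /=.
by apply: plane_eq; rewrite /= /GRing.scale /=; ring.
Qed.

Lemma same_turn_shift T F G a : same_turn T F G ->
  same_turn T (fun t => F (t + a)) (fun t => G (t + a)).
Proof.
move=> [th [cth pth E]]; exists (fun t => th (t + a)); split=> //.
- by continuity.
- by move=> t; rewrite addrAC pth.
Qed.

Lemma same_turn_opp T F : same_turn T F (fun t => - F t).
Proof.
exists (fun=> pi); split=> //; first exact: cont_cst.
move=> t; exists 1 => //; rewrite /cmul /cis cospi sinpi /= scale1r.
by apply: plane_eq; rewrite /=; ring.
Qed.

(** When F and G never make an obtuse or right angle, the angle between them is
    given by the arctangent, hence continuous and periodic. *)
Lemma same_turn_dotp T F G : continuous F -> continuous G ->
  (forall t, F (t + T) = F t) -> (forall t, G (t + T) = G t) ->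
  (forall t, 0 < dotp (F t) (G t)) -> same_turn T F G.
Proof.
move=> cF cG pF pG FG.
pose b t := (F t).1 * (G t).2 - (F t).2 * (G t).1.
exists (fun t => atan (b t / dotp (F t) (G t))); split.
- rewrite /b /dotp; continuity; apply: cont_inv; last by continuity.
  by move=> t; rewrite gt_eqF // FG.
- by move=> t; rewrite /b /dotp pF pG.
move=> t; set D := dotp _ _; set th := atan _.
have D0 : 0 < D := FG t.
have c0 : 0 < cos th by apply: cos_gt0_pihalf; rewrite atan_gtNpi2 atan_ltpi2.
have tanE : sin th = cos th * (b t / D).
  by rewrite -(atanK (b t / D)) -/th /tan mulrCA divff ?mulr1 // gt_eqF.
have N0 : 0 < (F t).1 ^+ 2 + (F t).2 ^+ 2.
  rewrite lt_neqAle eq_sym paddr_eq0 ?sqr_ge0 // !sqrf_eq0.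
  rewrite addr_ge0 ?sqr_ge0 // andbT.
  apply/negP => /andP[/eqP F1 /eqP F2].
  by have := FG t; rewrite /dotp F1 F2 !mul0r addr0 ltxx.
exists (D / cos th / ((F t).1 ^+ 2 + (F t).2 ^+ 2)); first by rewrite !divr_gt0.
rewrite /cmul /cis /= tanE /b /D /dotp.
have := lt0r_neq0 N0; have := lt0r_neq0 D0; have := lt0r_neq0 c0.
rewrite /D /dotp; case: (G t) (F t) => [g1 g2] [f1 f2] /=.
move=> h1 h2 h3; apply: plane_eq; rewrite /= /GRing.scale /=;
 by field; rewrite ?h1 ?h2 ?h3.
Qed.

End turning.

Section homotopy.
Context {R : realType}.
Implicit Types (T : R) (F G H : R -> R * R) (z w : R * R).

Lemma periodic_reduce (Y : Type) T (F : R -> Y) : 0 < T ->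
  (forall t, F (t + T) = F t) ->
  forall t, exists2 s, 0 <= s < T & (F t = F s /\ s = t - T * (Num.floor (t / T))%:~R).
Proof.
move=> T0 pF t; have pFn (n : nat) s : F (s + T *+ n) = F s.
  by elim: n => [|n IH]; rewrite ?mulr0n ?addr0// mulrS addrCA addrC pF IH.
have pFz (m : int) s : F (s + T * m%:~R) = F s.
  case: m => n; first by rewrite -pmulrn mulr_natr pFn.
  rewrite -(pFn n.+1 (s + _)) NegzE mulrNz mulrN.
  by rewrite -pmulrn mulr_natr addrNK.
exists (t - T * (Num.floor (t / T))%:~R); last first.
  by split=> //; rewrite -mulrN -mulrNz pFz.
have := Num.Theory.floor_itv (t / T).
rewrite ler_pdivlMr // ltr_pdivrMr // intrD; move: (_%:~R) => k /andP[a b].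
by apply/andP; split; lra.
Qed.

Lemma dotp_self_gt0 z : z != 0 -> 0 < dotp z z.
Proof.
move=> z0; rewrite /dotp -!expr2 lt_neqAle eq_sym paddr_eq0 ?sqr_ge0 //.
rewrite !sqrf_eq0 addr_ge0 ?sqr_ge0 // andbT; apply: contra z0 => /andP[/eqP a /eqP b].
by apply/eqP; exact: plane_eq.
Qed.

(** Two nearby loops of the homotopy make acute angles at all times, by
    compactness of a period, so the class is locally constant in s. *)
Lemma same_turn_homotopy T (P : R -> R -> R * R) : 0 < T ->
  continuous (fun p : R * R => P p.1 p.2) ->
  (forall s t, P s (t + T) = P s t) ->
  (forall s t, 0 <= s <= 1 -> P s t != 0) ->
  same_turn T (P 0) (P 1).
Proof.
move=> T0 cP pP nP.
apply: (@unit_interval_chain _ (fun s => same_turn T (P 0) (P s))); last first.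
  exact: same_turn_refl.
move=> s0 s01.
have cPs s : continuous (P s).
  have c2 : continuous (fun t : R => (s, t)) by continuity.
  exact: (cont_comp cP c2).
have K : \forall s \near s0, [set` `[0%R, T]] `<=` (fun t => 0 < dotp (P s0 t) (P s t)).
  have := (compact_near_coveringP [set` `[0%R, T]]).1 (@segment_compact R 0 T).
  move=> /(_ R (nbhs s0) (fun s t => 0 < dotp (P s0 t) (P s t))); apply.
  move=> t _.
  have cD : continuous (fun p : R * R => dotp (P s0 p.1) (P p.2 p.1)).
    have c1 : continuous (fun p : R * R => P p.2 p.1).
      have c2 : continuous (fun p : R * R => (p.2, p.1)) by continuity.
      exact: (cont_comp cP c2).
    have c3 : continuous (fun p : R * R => P s0 p.1).
      by apply: (cont_comp (cPs s0)); continuity.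
    by rewrite /dotp; continuity.
  have := cD (t, s0); move/cvgrPdist_lt => /(_ _ (dotp_self_gt0 (nP s0 t s01))).
  rewrite /=.
  have : dotp (P s0 t) (P s0 t) = dotp (P s0 (t, s0).1) (P (t, s0).2 (t, s0).1) by [].
  move=> ->; apply: filterS => p /=.
  by rewrite ltr_distl => /andP[_]; rewrite -[X in X < _]add0r ltrD2r.
move: K; apply: filterS => s K s01'.
have dp t : 0 < dotp (P s0 t) (P s t).
  have [u /andP[u0 uT] [E _]] :=
    periodic_reduce T0 (F:=fun t => dotp (P s0 t) (P s t)) (fun t => congr2 dotp (pP _ _) (pP _ _)) t.
  by rewrite E; apply: K; rewrite /= in_itv /= u0 ltW.
have E := same_turn_dotp (cPs s0) (cPs s) (pP _) (pP _) dp.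
by split=> A; apply: (same_turn_trans A) => //; exact: same_turn_sym.
Qed.

Lemma nonvanishing_sign (u : R -> R) : continuous u -> (forall t, u t != 0) ->
  forall s t, 0 < u s * u t.
Proof.
move=> cu u0.
suff H s t : s <= t -> 0 < u s * u t.
  by move=> s t; case: (leP s t) => [|/ltW] /H; rewrite // mulrC.
move=> st; rewrite ltNge; apply/negP => neg.
have [|c _ c0] := IVT (v := 0) st (continuous_subspaceT cu).
  by rewrite ge_min le_max; nra.
by move: (u0 c); rewrite c0 eqxx.
Qed.

(** A field with F (t + T / 2) = - F (t) makes an odd number of turns, so its
    square makes twice an odd number of turns and never zero.  If the square had
    a periodic angle th, then F would be a nowhere zero real function times the
    unit vector of angle th / 2; the half-period increment D of th / 2 would have
    negative cosine everywhere, although D (T / 2) = - D (0) forces D to vanish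
    somewhere. *)
Lemma antipodal_square_turns T F : 0 < T -> continuous F ->
  (forall t, F t != 0) -> (forall t, F (t + T / 2) = - F t) ->
  ~ same_turn T (fun=> (1, 0)) (fun t => cmul (F t) (F t)).
Proof.
move=> T0 cF F0 aF [th [cth pth E]].
(* w is the coordinate of F along the unit vector of angle th / 2. *)
pose w t := dotp (F t) (cis (th t / 2)).
have cw : continuous w by rewrite /w /dotp /cis; continuity.
have FE t : w t != 0 /\ F t = w t *: cis (th t / 2).
  have [r r0 Er] := E t; have E1 := congr1 fst Er; have E2 := congr1 snd Er.
  move: (F0 t) E1 E2; rewrite /w /dotp /cis /cmul /=.
  have -> : th t = th t / 2 + th t / 2 by exact: splitr.
  rewrite cosD sinD -splitr.
  have := cis_norm (th t / 2).
  set C := cos _; set S := sin _; case: (F t) => [a b] /=.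
  rewrite /GRing.scale /= => CS ab0; rewrite !mulr1 !mulr0 subr0 ?addr0 ?add0r => E1 E2.
  have e1 : (a * C + b * S) * (b * C - a * S) = 0.
    have -> : (a * C + b * S) * (b * C - a * S) =
       (a * b + b * a) / 2 * (C * C - S * S) - (a * a - b * b) * (C * S) by field.
    by rewrite E1 E2; field.
  have e2 : 0 < (a * C + b * S) ^+ 2 - (b * C - a * S) ^+ 2.
    have -> : (a * C + b * S) ^+ 2 - (b * C - a * S) ^+ 2 =
      (a * a - b * b) * (C * C - S * S) + (a * b + b * a) * (C * S + S * C) by ring.
    rewrite E1 E2.
    have -> : r * (C * C - S * S) * (C * C - S * S) + r * (S * C + C * S) * (C * S + S * C)
      = r * (C ^+ 2 + S ^+ 2) ^+ 2 by ring.
    by rewrite CS expr1n mulr1.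
  have n0 : a * C + b * S != 0.
    by apply/negP => /eqP z0; move: e2; rewrite z0; nra.
  split=> //; move: e1 => /eqP; rewrite mulf_eq0 (negPf n0) /= => {}e1.
  have {}e1 : b * C - a * S = 0 by apply/eqP.
  apply: plane_eq; rewrite /= /GRing.scale /=.
    have -> : (a * C + b * S) * C =
        a * (C ^+ 2 + S ^+ 2) + S * (b * C - a * S) by ring.
    by rewrite CS e1 mulr0 mulr1 addr0.
  have -> : (a * C + b * S) * S =
      b * (C ^+ 2 + S ^+ 2) - C * (b * C - a * S) by ring.
  by rewrite CS e1 mulr0 mulr1 subr0.
pose D t := (th (t + T / 2) - th t) / 2.
have cD : continuous D by rewrite /D; continuity.
have cosD t : cos (D t) < 0.
  have [w0 Ft] := FE t; have [w0' Ft'] := FE (t + T / 2).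
  have ww := nonvanishing_sign cw (fun t => (FE t).1) t (t + T / 2).
  have := congr1 snd (aF t); have := congr1 fst (aF t); rewrite Ft Ft' /=.
  rewrite /GRing.scale /= /D mulrBl cosB.
  have := cis_norm (th t / 2).
  move: (cos (th t / 2)) (sin (th t / 2)) => C S CS.
  move: (cos _) (sin _) => C' S' e1 e2.
  have : w (t + T / 2) * (C' * C + S' * S) = - w t.
    have -> : w (t + T / 2) * (C' * C + S' * S) =
      w (t + T / 2) * C' * C + w (t + T / 2) * S' * S by ring.
    rewrite e1 e2.
    have -> : - (w t * C) * C + - (w t * S) * S = - w t * (C ^+ 2 + S ^+ 2) by ring.
    by rewrite CS mulr1.
  move: ww; move: (w t) (w (t + T / 2)) (C' * C + S' * S) => x y z; nra.
have DD : D (T / 2) = - D 0.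
  rewrite /D add0r -splitr.
  have -> : th T = th 0 by rewrite -[T]add0r pth.
  by rewrite -mulNr opprB.
have [||c _ c0] := IVT (v := 0) (a := 0) (b := T / 2) _ (continuous_subspaceT cD).
- by rewrite divr_ge0 // ltW.
- by rewrite DD ge_min le_max; lra.
by move: (cosD c); rewrite c0 cos0 ltr10.
Qed.
End homotopy.

Section closed_chain.
Context {R : realType}.
Implicit Types (T : R) (F G H : R -> R * R) (z w : R * R).

Lemma continuous_gluing (Y : topologicalType) T (f : R -> Y) (g : int -> R -> Y) :
  0 < T -> (forall m, continuous (g m)) ->
  (forall m t, m%:~R * T <= t <= (m%:~R + 1) * T -> f t = g m t) ->
  continuous f.
Proof.
move=> T0 cg fg t; pose m := Num.floor (t / T).
have /andP[mt tm] : m%:~R * T <= t < (m%:~R + 1) * T.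
  have := Num.Theory.floor_itv (t / T).
  by rewrite ler_pdivlMr // ltr_pdivrMr // intrD.
have fm : f t = g m t by apply: fg; rewrite mt ltW.
have near_m (A : set Y) : nbhs (f t) A -> \forall s \near t, A (g m s).
  by rewrite fm; exact: cg.
have ub : \forall s \near t, s < (m%:~R + 1) * T by exact: lt_nbhsl.
have [mt'|tm'] := ltP (m%:~R * T) t.
  move=> A fA; have lb : \forall s \near t, m%:~R * T < s by exact: lt_nbhsr.
  have nA := near_m A fA.
  change (\forall s \near t, A (f s)); near=> s.
  rewrite (fg m); first by near: s.
  by rewrite !ltW//; near: s.
have tE : t = m%:~R * T by apply/eqP; rewrite eq_le tm' mt.
have fm1 : f t = g (m - 1) t.
  by apply: fg; rewrite intrD tE subrK lexx andbT; nra.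
move=> A fA; have nA := near_m A fA.
have nA1 : \forall s \near t, A (g (m - 1) s) by move: fA; rewrite fm1; exact: cg.
have lb : \forall s \near t, (m%:~R - 1) * T < s by apply: lt_nbhsr; rewrite tE; nra.
change (\forall s \near t, A (f s)); near=> s.
have [ms|sm] := leP (m%:~R * T) s.
  rewrite (fg m); first by near: s.
  by rewrite ms ltW//; near: s.
rewrite (fg (m - 1)); first by near: s.
rewrite intrD subrK (ltW sm) andbT ltW//; near: s; exact: lb.
Unshelve. all: by end_near. Qed.

Lemma same_turn_cst T z : 0 < T -> z != 0 -> same_turn T (fun=> (1, 0)) (fun=> z).
Proof.
move=> T0 z0.
have pos w : 0 < w.1 -> same_turn T (fun=> (1, 0)) (fun=> w).
  move=> w0; apply: same_turn_dotp => //; [exact: cont_cst|exact: cont_cst|].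
  by move=> t; rewrite /dotp /= mul1r mul0r addr0.
have [w2|z2] := eqVneq z.2 0; last first.
  pose P (s t : R) : R * R := (1 - s, 0) + s *: z.
  have P0 : P 0 = fun=> (1, 0).
    by apply: funext => t; rewrite /P subr0 scale0r addr0.
  have P1 : P 1 = fun=> z.
    apply: funext => t; rewrite /P subrr scale1r.
    by apply: plane_eq; rewrite /= add0r.
  rewrite -P0 -P1; apply: same_turn_homotopy => //.
  - by rewrite /P; continuity.
  - move=> s t s01; apply/eqP => /pair_equal_spec/= [a b].
    move: b; rewrite add0r /GRing.scale /= => /eqP.
    rewrite mulf_eq0 (negPf z2) orbF => /eqP s0.
    by move: a; rewrite s0 subr0 /GRing.scale /= mul0r addr0 => /eqP; rewrite oner_eq0.
have [z1|z1|z1] := ltgtP z.1 0.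
- have := pos (- z); rewrite /= oppr_gt0 z1 => /(_ isT) h.
  have -> : (fun _ : R => z) = (fun=> - - z) by rewrite opprK.
  by apply: (same_turn_trans h); exact: same_turn_opp.
- exact: pos.
- by move: z0; rewrite (plane_eq (z := z) (w := 0) z1 w2) eqxx.
Qed.

Lemma cmul11 : cmul (1, 0) (1, 0) = (1, 0) :> R * R.
Proof. by apply: plane_eq => /=; ring. Qed.

Lemma dotp_close (z w : R * R) (k : R) : `|w - z| <= k -> 2 * k < `|z| -> 0 < dotp z w.
Proof.
move=> wz kz.
have n1 : `|z.1| <= `|z| by rewrite le_max lexx.
have n2 : `|z.2| <= `|z| by rewrite le_max lexx orbT.
have d1 : `|w.1 - z.1| <= k by apply: le_trans wz; rewrite le_max lexx.
have d2 : `|w.2 - z.2| <= k by apply: le_trans wz; rewrite le_max lexx orbT.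
have zz : `|z| ^+ 2 <= z.1 ^+ 2 + z.2 ^+ 2.
  have -> : `|z| = Num.max `|z.1| `|z.2| by [].
  rewrite -(real_normK (num_real z.1)) -(real_normK (num_real z.2)).
  by case: (leP `|z.1| `|z.2|) => _; rewrite ?lerDl ?lerDr sqr_ge0.
have k0 : 0 <= k by exact: le_trans d1.
have b1 : `|z.1 * (w.1 - z.1)| <= `|z| * k by rewrite normrM ler_pM.
have b2 : `|z.2 * (w.2 - z.2)| <= `|z| * k by rewrite normrM ler_pM.
move: b1 b2; rewrite !ler_norml => /andP[b1 _] /andP[b2 _].
have -> : dotp z w = z.1 ^+ 2 + z.2 ^+ 2 + (z.1 * (w.1 - z.1)) + (z.2 * (w.2 - z.2)).
  by rewrite /dotp; ring.
have : 0 < `|z| * (`|z| - 2 * k).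
  by apply: mulr_gt0; rewrite ?subr_gt0 //; lra.
by nra.
Qed.
End closed_chain.

(** * Closed chains *)

Section closed_chain.
Context {R : realType}.

(** The index of h along the chain, computed twice, is the number of turns of an
    antipodal field, hence odd.  The role of orientation is played by the bounded
    displacement K: an injective h at bounded distance from the identity
    preserves the turning of differences of loops, because rescaling by a large
    factor makes h (x) - h (y) nearly parallel to x - y. *)
Lemma closed_chain_fixed_point (h : R * R -> R * R) (K : R) (n : nat)
    (G : R -> R * R) :
  continuous h -> injective h -> (forall z, `|h z - z| <= K) -> (2 <= n)%N ->
  continuous G -> (forall t, 0 <= t -> G (t + 1) = h (G t)) -> G n%:R = G 0 ->
  (forall s t, 0 <= s -> 1 <= t - s <= n%:R - 1 -> G s <> G t) ->
  exists z, h z = z.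
Proof.
move=> ch ih hK n2 cG Gh Gn Gsep; apply: contrapT => nofix.
have hz z : h z - z != 0.
  by rewrite subr_eq0; apply/eqP => hzz; apply: nofix; exists z.
set T : R := n%:R in Gn Gsep.
have T2 : 2 <= T by rewrite ler_nat.
have T0 : 0 < T by lra.
pose c t := G (t - T * (Num.floor (t / T))%:~R).
have cgl m t : m%:~R * T <= t <= (m%:~R + 1) * T -> c t = G (t - m%:~R * T).
  move=> /andP[mt tm]; have [tm'|tm'] := ltP t ((m%:~R + 1) * T).
    have -> : c t = G (t - T * m%:~R); last by rewrite mulrC.
    rewrite /c; congr (G (t - T * _%:~R)); apply: floor_def.
    by rewrite ler_pdivlMr // ltr_pdivrMr // intrD mt.
  have tE : t = (m%:~R + 1) * T by apply/eqP; rewrite eq_le tm' tm.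
  have -> : c t = G (t - T * (m%:~R + 1)).
    rewrite /c; have -> : m%:~R + 1 = (m + 1)%:~R :> R by rewrite intrD.
    congr (G (t - T * _%:~R)); apply: floor_def.
    rewrite tE ler_pdivlMr // ltr_pdivrMr // !intrD lexx /=; nra.
  rewrite tE; have -> : (m%:~R + 1) * T - T * (m%:~R + 1) = 0 by ring.
  by rewrite -Gn; congr G; ring.
have cc : continuous c.
  apply: (continuous_gluing (g := fun m t => G (t - m%:~R * T)) T0) => // m.
  have : continuous (fun t : R => t - m%:~R * T) by continuity.
  exact: cont_comp.
have cE0 t : 0 <= t <= T -> c t = G t.
  by move=> t0; rewrite (@cgl 0) ?mul0r ?add0r ?mul1r ?subr0.
have pc t : c (t + T) = c t.
  have := Num.Theory.floor_itv (t / T); set m := Num.floor _.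
  rewrite ler_pdivlMr // ltr_pdivrMr // intrD => /andP[mt tm].
  rewrite (@cgl (m + 1)) ?intrD; last by apply/andP; split; nra.
  rewrite (@cgl m); last by rewrite mt ltW.
  by congr G; ring.
pose E t := h (c t).
have cE : continuous E by exact: cont_comp.
have pE t : E (t + T) = E t by rewrite /E pc.
have pcs s t : c (t + T + s) = c (t + s) by rewrite addrAC pc.
have pEs s t : E (t + T + s) = E (t + s) by rewrite addrAC pE.
have ind (F : R -> Prop) : (forall t, F (t + T) = F t) ->
    (forall t, 0 <= t < T -> F t) -> forall t, F t.
  by move=> pF F0 t; have [s /F0 Fs [-> _]] := periodic_reduce T0 pF t.
have csep s t : 1 <= s <= T - 1 -> c (t + s) <> c t.
  move=> /andP[s1 sT]; move: t; apply: ind => [t|t /andP[t0 tT]].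
    by rewrite pc addrAC pc.
  rewrite (cE0 t) ?t0 ?ltW//; have [ts|ts] := leP (t + s) T.
    rewrite cE0; last by lra.
    by apply: nesym; apply: Gsep => //; lra.
  rewrite -(subrK T (t + s)) pc cE0; last by lra.
  by apply: Gsep; lra.
have Ec t : 0 <= t <= T - 1 -> E t = c (t + 1).
  by move=> t0; rewrite /E !cE0 ?Gh//; lra.
have Esep s t : 0 <= s <= T - 2 -> E (t + s) <> c t.
  move=> s0; suff H u : E u <> c (u - s) by have := H (t + s); rewrite addrK.
  move: u; apply: ind => [u|u /andP[u0 uT]].
    by rewrite pE pcs.
  have [u1|u1] := leP u (T - 1).
    rewrite Ec ?u0//; have := @csep (s + 1) (u - s).
    rewrite addrA subrK; apply; lra.
  have -> : c (u - s) = E (u - s - 1) by rewrite Ec ?subrK//; lra.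
  move=> /ih; have := @csep (s + 1) (u - s - 1).
  by rewrite -[u - s - 1]addrA -opprD subrK; apply; lra.
pose N := same_turn T (fun=> (1, 0) : R * R).
(* Without fixed points h (k c) - k c never vanishes for k from 0 to 1, so E - c
   does not turn. *)
have N1 : N (fun t => E t - c t).
  pose P (s t : R) := h (s *: c t) - s *: c t.
  have -> : (fun t => E t - c t) = P 1 by apply: funext => t; rewrite /P scale1r.
  apply: (@same_turn_trans _ _ _ (P 0)).
    have -> : P 0 = fun=> h 0 - 0.
      by apply: funext => t; rewrite /P scale0r.
    exact: same_turn_cst.
  apply: same_turn_homotopy => //; first by rewrite /P; continuity.
    by move=> s t; rewrite /P pc.
  by move=> s t _; exact: hz.
have N2 : N (fun t => E (t + 1) - c (t + 1)) by exact: (same_turn_shift 1 N1).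
(* E (t + s) - c (t) does not vanish for s from 0 to n - 2; at s = n - 2 it is,
   up to sign and a time shift, c (t + 2) - E (t). *)
have N3 : N (fun t => c (t + 1 + 1) - E t).
  have -> : (fun t => c (t + 1 + 1) - E t) = (fun t => c (t + 2) - E (t + 2 + (T - 2))).
    apply: funext => t; congr (c _ - _); first by rewrite -addrA.
    by rewrite -(pE t); congr E; ring.
  apply: (same_turn_shift (F := fun=> (1, 0)) (G := fun t => c t - E (t + (T - 2))) 2).
  have -> : (fun t => c t - E (t + (T - 2))) = (fun t => - (E (t + (T - 2)) - c t)).
    by apply: funext => t; rewrite opprB.
  apply: same_turn_trans (same_turn_opp _ _).
  apply: (same_turn_trans N1).
  pose P (s t : R) := E (t + s * (T - 2)) - c t.
  have -> : (fun t => E t - c t) = P 0.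
    by apply: funext => t; rewrite /P mul0r addr0.
  have -> : (fun t => E (t + (T - 2)) - c t) = P 1.
    by apply: funext => t; rewrite /P mul1r.
  apply: same_turn_homotopy => //; first by rewrite /P; continuity.
    by move=> s t; rewrite /P pEs pc.
  move=> s t s01; rewrite /P subr_eq0; apply/eqP/Esep; nra.
(* At each time E (t) = c (t + 1) or E (t + 1) = c (t + 2). *)
have N4 : N (fun t => cmul (E (t + 1) - E t) (c (t + 1 + 1) - c (t + 1))).
  have -> : (fun t => cmul (E (t + 1) - E t) (c (t + 1 + 1) - c (t + 1))) =
     (fun t => cmul (E (t + 1) - c (t + 1)) (c (t + 1 + 1) - E t)).
    apply: funext; apply: ind => [t|t /andP[t0 tT]]; first by rewrite !pE !(addrAC _ T) !pc pE.
    have [t1|t1] := leP t (T - 1); first by rewrite (Ec t) ?t0.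
    have -> : E (t + 1) = c (t + 1 + 1).
      rewrite -(subrK T (t + 1)) pE Ec; last by lra.
      by rewrite -pc; congr c; ring.
    by rewrite /cmul; apply: plane_eq => /=; ring.
  have := same_turn_mul N2 N3.
  by have -> : (fun _ : R => cmul (1, 0) (1, 0)) = (fun=> (1, 0) : R * R)
    by apply: funext => t; rewrite cmul11.
pose v t := c (t + T / 2) - c t.
have V1 : same_turn T (fun t => c (t + 1 + 1) - c (t + 1)) v.
  pose P (s t : R) := c (t + (2 + s * (T / 2 - 2))) - c (t + (1 - s)).
  have -> : (fun t => c (t + 1 + 1) - c (t + 1)) = P 0.
    by apply: funext => t; rewrite /P mul0r addr0 subr0 -addrA.
  have -> : v = P 1.
    by apply: funext => t; rewrite /P mul1r subrr addr0 [2 + _]addrC subrK.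
  apply: same_turn_homotopy => //; first by rewrite /P; continuity.
    by move=> s t; rewrite /P !pcs.
  move=> s t s01; rewrite /P subr_eq0; apply/eqP.
  have -> : t + (2 + s * (T / 2 - 2)) = t + (1 - s) + (1 + s * (T / 2 - 1)) by field.
  by apply: csep; nra.
have V2 : same_turn T (fun t => c (t + 1) - c t) v.
  pose P (s t : R) := c (t + (1 + s * (T / 2 - 1))) - c t.
  have -> : (fun t => c (t + 1) - c t) = P 0.
    by apply: funext => t; rewrite /P mul0r addr0.
  have -> : v = P 1.
    by apply: funext => t; rewrite /P mul1r [1 + _]addrC subrK.
  apply: same_turn_homotopy => //; first by rewrite /P; continuity.
    by move=> s t; rewrite /P !pcs pc.
  by move=> s t s01; rewrite /P subr_eq0; apply/eqP/csep; nra.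
(* The homotopy h (k c (t + 1)) - h (k c (t)), with k from 1 to L, avoids 0 by
   injectivity; for k = L the displacement of h is negligible. *)
have V3 : same_turn T (fun t => c (t + 1) - c t) (fun t => E (t + 1) - E t).
  have cn : {within `[0, T], continuous (fun t => `|c (t + 1) - c t|)}.
    by apply: continuous_subspaceT; continuity.
  have [d d0 dmin] := EVT_min (ltW T0) cn.
  have sep_gt0 t : 0 < `|c (t + 1) - c t|.
    by rewrite normr_gt0 subr_eq0; apply/eqP/csep; lra.
  have dmin' t : `|c (d + 1) - c d| <= `|c (t + 1) - c t|.
    move: t; apply: ind => [t|t /andP[t0 tT]]; first by rewrite pcs pc.
    by apply: dmin; rewrite in_itv /= t0 ltW.
  have [dl dl0 dlE] : exists2 dl, 0 < dl & forall t, dl <= `|c (t + 1) - c t|.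
    by exists `|c (d + 1) - c d|.
  have K0 : 0 <= K by exact: le_trans (hK 0).
  pose L := 1 + (4 * K + 1) / dl.
  have L1 : 1 <= L by rewrite /L lerDl divr_ge0 ?ltW//; lra.
  have LK t : 4 * K < `|L *: (c (t + 1) - c t)|.
    rewrite normrZ ger0_norm; last by lra.
    apply: (@lt_le_trans _ _ (L * dl)); last by rewrite ler_wpM2l//; lra.
    have -> : L * dl = dl + (4 * K + 1) by rewrite /L; field; rewrite gt_eqF.
    by lra.
  have L0 : 0 < L by lra.
  apply: (same_turn_trans (same_turn_scale T _ (fun _ : R => L0))).
  apply: (@same_turn_trans _ _ _ (fun t => h (L *: c (t + 1)) - h (L *: c t))).
    apply: same_turn_dotp.
    - by continuity.
    - by continuity.
    - by move=> t; rewrite pcs pc.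
    - by move=> t; rewrite pcs pc.
    move=> t; apply: (@dotp_close _ _ _ (2 * K)); last by have := LK t; lra.
    have -> : h (L *: c (t + 1)) - h (L *: c t) - L *: (c (t + 1) - c t) =
      (h (L *: c (t + 1)) - L *: c (t + 1)) - (h (L *: c t) - L *: c t).
      by rewrite scalerBr !opprD !opprK addrACA.
    by apply: le_trans (ler_normB _ _) _; rewrite mulr_natl mulr2n lerD.
  apply: same_turn_sym.
  pose P (s t : R) := h ((1 + s * (L - 1)) *: c (t + 1)) - h ((1 + s * (L - 1)) *: c t).
  have -> : (fun t => E (t + 1) - E t) = P 0.
    by apply: funext => t; rewrite /P mul0r addr0 !scale1r.
  have -> : (fun t => h (L *: c (t + 1)) - h (L *: c t)) = P 1.
    by apply: funext => t; rewrite /P mul1r [1 + _]addrC subrK.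
  apply: same_turn_homotopy => //; first by rewrite /P; continuity.
    by move=> s t; rewrite /P !pcs pc.
  move=> s t s01; rewrite /P subr_eq0; apply/eqP => /ih /scalerI.
  have s0 : 1 + s * (L - 1) != 0 by apply: lt0r_neq0; nra.
  by move=> /(_ s0); apply: csep; lra.
have Nv : N (fun t => cmul (v t) (v t)).
  apply: (same_turn_trans N4); apply: same_turn_mul => //.
  by apply: (same_turn_trans (same_turn_sym V3)).
apply: (antipodal_square_turns T0 _ _ _ Nv).
- by rewrite /v; continuity.
- by move=> t; rewrite /v subr_eq0; apply/eqP/csep; lra.
- by move=> t; rewrite /v -addrA -splitr pc opprB.
Qed.
End closed_chain.

(** * Translation chains and pushes *)

Section chain.
Context {R : realType}.
Implicit Types (w z : R * R).

Lemma cont_iter (X : topologicalType) (h : X -> X) k : continuous h -> continuous (iter k h).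
Proof.
move=> ch; elim: k => [|k IH] /=; first exact: cont_id.
exact: (cont_comp ch IH).
Qed.

Lemma inj_iter (X : Type) (h : X -> X) k : injective h -> injective (iter k h).
Proof. by move=> ih; elim: k => [|k IH] x y //= /ih /IH. Qed.

(** An arc al from al (0) to h (al (0)) whose images are disjoint up to order n
    produces a closed chain as soon as one of its points has period n; the chain
    starts at that point and follows the successive images of al. *)
Lemma translation_chain_fixed_point (h : R * R -> R * R) (K : R) (n : nat)
    (al : R -> R * R) (t0 : R) :
  continuous h -> injective h -> (forall z, `|h z - z| <= K) -> (2 <= n)%N ->
  continuous al -> (forall u, u <= 0 -> al u = al 0) -> h (al 0) = al 1 ->
  0 <= t0 < 1 -> iter n h (al t0) = al t0 ->
  (forall k p q, (0 < k < n)%N -> 0 <= p < 1 -> 0 <= q < 1 ->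
     al p <> iter k h (al q)) ->
  exists z, h z = z.
Proof.
move=> ch ih hK n2 ca al0 hal t01 per sep.
pose G (t : R) := iter (Num.truncn t) h (al (t - (Num.truncn t)%:R)).
have truncE (k : nat) (t : R) : k%:R <= t < k.+1%:R -> Num.truncn t = k.
  by move=> kt; exact: truncn_def.
have Ggl (k : nat) (t : R) : k%:R <= t <= k.+1%:R -> G t = iter k h (al (t - k%:R)).
  move=> /andP[kt]; rewrite le_eqVlt => /predU1P[->|tk].
    rewrite /G (@truncE k.+1); last by rewrite lexx ltr_nat /=.
    by rewrite subrr -natr1 addrAC subrr add0r -hal iterSr.
  by rewrite /G (@truncE k) // kt.
have cG : continuous G.
  pose g (m : int) (t : R) := if m is Posz k then iter k h (al (t - k%:R)) else al 0.
  apply: (continuous_gluing (T := 1) (g := g)) => //.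
    case=> k; rewrite /g; last exact: cont_cst.
    apply: (cont_comp (cont_iter (k := k) ch)).
    by apply: (cont_comp ca); continuity.
  case=> k t; rewrite !mulr1 /g.
    by rewrite -pmulrn natr1; exact: Ggl.
  move=> /andP[_ t1]; rewrite /G.
  have t0' : t <= 0.
    apply: (le_trans t1); rewrite NegzE mulrNz -pmulrn addrC subr_le0.
    by rewrite ler1n.
  have -> : Num.truncn t = 0%N.
    by apply/truncn0Pn; rewrite -ltNge; lra.
  by rewrite subr0 al0.
have GS t : 0 <= t -> G (t + 1) = h (G t).
  move=> t_ge0; have := truncn_itv t_ge0; set k := Num.truncn t => /andP[kt tk].
  rewrite (@Ggl k.+1) -?[k.+2%:R]natr1 -?natr1 ?lerD2r ?kt ?natr1 ?ltW//.
  rewrite (@Ggl k) ?kt ?ltW// iterS; congr (h (iter _ h (al _))).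
  by rewrite -natr1; ring.
apply: (closed_chain_fixed_point (n := n) (G := fun t => G (t + t0)) ch ih hK n2).
- by apply: (cont_comp cG); continuity.
- by move=> t t_ge0; rewrite addrAC GS//; lra.
- rewrite add0r (@Ggl n) -?natr1; last by lra.
  rewrite (@Ggl 0%N); last by lra.
  by rewrite addrAC subrr add0r subr0 per.
- move=> s t s_ge0 st; set s' := s + t0; set t' := t + t0.
  have s'_ge0 : 0 <= s' by rewrite /s'; lra.
  have t'_ge0 : 0 <= t' by rewrite /t'; lra.
  have := truncn_itv s'_ge0; have := truncn_itv t'_ge0; rewrite /G.
  set j := Num.truncn t'; set i := Num.truncn s'; rewrite -!natr1 => jt si.
  have ij : (i < j)%N by rewrite -(ltr_nat R); rewrite /s' /t' in jt si; lra.
  have jin : (j - i < n)%N.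
    by rewrite -(ltr_nat R) natrB ?(ltnW ij)//; rewrite /s' /t' in jt si; lra.
  rewrite -[j](subnKC (ltnW ij)) iterD => /(inj_iter ih).
  by apply: sep; rewrite ?subn_gt0 ?ij ?jin ?subnKC ?(ltnW ij)//; lra.
Qed.

Definition clamp (t : R) := Num.max 0 (Num.min t 1).

(** The displacement by d, cut off linearly at distance eta from p, is a
    Lipschitz map of constant at most 1/2, so adding it to the identity keeps
    injectivity. *)
Lemma push_small (p d : R * R) (eta : R) : 0 < eta -> 2 * `|d| <= eta ->
  exists phi : R * R -> R * R,
  [/\ continuous phi, injective phi, phi p = p + d &
     forall w, eta <= `|w - p| -> phi w = w].
Proof.
move=> e0 de; pose b w := Num.max 0 (1 - `|w - p| / eta).
have bL w w' : `|b w - b w'| <= `|w - w'| / eta.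
  have L1 : `| `|w' - p| / eta - `|w - p| / eta | <= `|w - w'| / eta.
    rewrite -mulrBl normrM [`|eta^-1|]gtr0_norm ?invr_gt0//.
    rewrite ler_pM2r ?invr_gt0// distrC; apply: le_trans (ler_dist_dist _ _) _.
    by rewrite opprB addrA subrK.
  apply: le_trans L1; rewrite /b.
  move: (`|w - p| / eta) (`|w' - p| / eta) => x y.
  by rewrite ler_norml; apply/andP; split; case: (leP 0 (1 - x)); case: (leP 0 (1 - y));
    case: (leP 0 (y - x)) => [h|h]; rewrite ?(ger0_norm h) ?(ltr0_norm h); lra.
exists (fun w => w + b w *: d); split.
- by rewrite /b; continuity; apply: cont_cst.
- move=> w w' E; apply/eqP; rewrite -subr_eq0 -normr_eq0.
  have EE : w - w' = (b w' - b w) *: d.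
    have wE : w = w' + b w' *: d - b w *: d by rewrite -E addrK.
    by rewrite {1}wE scalerBl addrAC [w' + _]addrC addrK.
  have := bL w' w; rewrite (distrC w' w) => bb.
  have n0 := normr_ge0 (w - w').
  have : `|w - w'| <= `|w - w'| / eta * `|d|.
    by rewrite {1}EE normrZ ler_wpM2r.
  have : `|w - w'| / eta * `|d| <= `|w - w'| / 2.
    rewrite -mulrA ler_wpM2l // mulrC ler_pdivrMr // mulrC; lra.
  by move=> *; apply/eqP; lra.
- rewrite /b subrr normr0 mul0r subr0; case: (leP 0 1) => [_|]; last by rewrite ltNge ler01.
  by rewrite scale1r.
- move=> w ew; rewrite /b.
  have -> : Num.max 0 (1 - `|w - p| / eta) = 0.
    by apply/max_idPl; rewrite subr_le0 ler_pdivlMr // mul1r.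
  by rewrite scale0r addr0.
Qed.

(** The segment from p to x stays at a positive distance eta from the boundary
    of the square, so it can be covered by finitely many small pushes. *)
Lemma push (z p x : R * R) (r : R) : `|p - z| < r -> `|x - z| < r ->
  exists phi : R * R -> R * R,
  [/\ continuous phi, injective phi, phi p = x,
     forall w, r <= `|w - z| -> phi w = w &
     forall w, `|w - z| < r -> `|phi w - z| < r].
Proof.
move=> pr xr; pose eta := r - Num.max `|p - z| `|x - z|.
have e0 : 0 < eta by rewrite subr_gt0 gt_max pr xr.
pose N := (Num.truncn (2 * `|x - p| / eta)).+1.
have NE : 2 * `|x - p| <= eta * N%:R.
  have := truncnS_gt (2 * `|x - p| / eta).
  by rewrite ltr_pdivrMr // [eta * _]mulrC => /ltW.
have N0 : 0 < N%:R :> R by rewrite ltr0n.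
suff [phi [cphi iphi phip phid]] : exists phi : R * R -> R * R,
  [/\ continuous phi, injective phi, phi p = p + (N%:R / N%:R : R) *: (x - p) &
     forall w, r <= `|w - z| -> phi w = w].
  exists phi; split=> //.
    by rewrite phip divff ?gt_eqF// scale1r addrC subrK.
  move=> w wr; rewrite ltNge; apply/negP => /[dup] pw /phid /iphi E.
  by move: pw; rewrite E leNgt wr.
have : (N <= N)%N by [].
elim: {1 3}N => [|k IH] kN.
  exists id; split=> //; first exact: cont_id.
  by rewrite mul0r scale0r addr0.
have [phi [cphi iphi phip phid]] := IH (ltnW kN).
pose d := (N%:R^-1 : R) *: (x - p).
set pk := p + (k%:R / N%:R : R) *: (x - p) in phip.
have [|psi [cpsi ipsi psip psid]] := push_small pk (d := d) e0.
  rewrite /d normrZ gtr0_norm ?invr_gt0//.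
  by rewrite mulrCA mulrC ler_pdivrMr.
exists (psi \o phi); split=> //=.
- exact: (cont_comp cpsi cphi).
- exact: inj_comp.
- rewrite phip psip /pk /d -addrA -scalerDl; congr (_ + _ *: _).
  by rewrite -natr1 mulrDl mul1r.
- move=> w wr; rewrite phid // psid //.
  have pkz : `|pk - z| <= Num.max `|p - z| `|x - z|.
    have -> : pk - z = (1 - k%:R / N%:R) *: (p - z) + (k%:R / N%:R : R) *: (x - z).
      rewrite /pk scalerBl scale1r -[RHS]addrA [- _ + _]addrC -scalerBr.
      by rewrite opprB addrA subrK addrAC.
    have k1 : 0 <= k%:R / N%:R :> R by rewrite divr_ge0.
    have k2 : k%:R / N%:R <= 1 :> R by rewrite ler_pdivrMr // mul1r ler_nat ltnW.
    apply: le_trans (ler_normD _ _) _; rewrite [X in X + _]normrZ [X in _ + X]normrZ [X in X * _ + _]ger0_norm ?subr_ge0// [X in _ + X * _]ger0_norm//.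
    set M := Num.max _ _.
    have a1 : `|p - z| <= M by rewrite le_max lexx.
    have a2 : `|x - z| <= M by rewrite le_max lexx orbT.
    by move: k1 k2 a1 a2; move: (_ / _) `|p - z| `|x - z| => a b e; nra.
  have := ler_normB (w - pk) (z - pk).
  have -> : w - pk - (z - pk) = w - z by rewrite opprB addrA subrK.
  by rewrite (distrC z) /eta; lra.
Qed.
End chain.

(** * Brouwer's lemma for free squares *)

Section free_square.
Context {R : realType}.
Implicit Types (w z : R * R).

Definition free_square (g : R * R -> R * R) z r :=
  forall w, `|w - z| < r -> r <= `|g w - z|.

Lemma compact_square z (r : R) : compact [set w : R * R | `|w - z| <= r].
Proof.
have -> : [set w : R * R | `|w - z| <= r] =
    [set` `[z.1 - r, z.1 + r]] `*` [set` `[z.2 - r, z.2 + r]].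
  apply/seteqP; split=> w /=; rewrite !in_itv /= -!ler_distl.
    by rewrite [`|w - z|]/Num.Def.normr /= ge_max => /andP.
  by move=> ab; rewrite [`|w - z|]/Num.Def.normr /= ge_max; apply/andP.
by apply: compact_setX; exact: segment_compact.
Qed.

(** The supremum r of the radii of free squares is attained, and the minimum of
    max (|w - z|, |g w - z|) cannot exceed r, or a larger square would be free. *)
Lemma maximal_free_square (g : R * R -> R * R) K z s : continuous g ->
  (forall w, `|g w - w| <= K) -> 0 < s -> free_square g z s ->
  exists r y, [/\ s <= r, free_square g z r, `|y - z| <= r & `|g y - z| <= r].
Proof.
move=> cg gK s0 fs; pose S := [set r : R | 0 < r /\ free_square g z r].
have Ss : S s by [].
have Sb : has_ubound S.
  exists K => r [r0 fr]; apply: le_trans (gK z).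
  by apply: fr; rewrite subrr normr0.
have hS : has_sup S by split=> //; exists s.
pose r := sup S.
have sr : s <= r by exact: ub_le_sup.
have fr : free_square g z r.
  move=> w wr; rewrite leNgt; apply/negP => gr.
  pose m := Num.max `|w - z| `|g w - z|.
  have mr : 0 < r - m by rewrite subr_gt0 gt_max wr gr.
  have [e [e0 fe]] := sup_adherent mr hS; rewrite opprB addrCA subrr addr0 gt_max.
  by move=> /andP[/fe]; rewrite leNgt => /negbTE ->.
pose u w := Num.max `|w - z| `|g w - z|.
have cu : continuous u by rewrite /u; continuity.
have [||y yr ymin] := compact_EVT_min (f := u) (A := [set w | `|w - z| <= r + 1]) _ _
  (continuous_subspaceT cu).
- by exists z => /=; rewrite subrr normr0; lra.
- exact: compact_square.
have ur : u y <= r.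
  rewrite leNgt; apply/negP => ru; pose e := Num.min 1 (u y - r).
  have e0 : 0 < e by rewrite lt_min ltr01 subr_gt0.
  have : ~ S (r + e).
    by move=> /(ub_le_sup Sb); rewrite gerDl leNgt e0.
  apply; split; first by lra.
  move=> w wr; rewrite leNgt; apply/negP => gwr.
  have : u y <= u w.
    apply: ymin; rewrite inE /=; have : e <= 1 by rewrite ge_min lexx.
    by lra.
  have : u w < r + e by rewrite /u gt_max wr.
  have : e <= u y - r by rewrite ge_min lexx orbT.
  lra.
exists r, y; split=> //; apply: le_trans ur; rewrite /u.
  by rewrite le_max lexx.
by rewrite le_max lexx orbT.
Qed.

Lemma square_closure z y (r : R) (U : set (R * R)) : 0 < r -> `|y - z| <= r ->
  nbhs y U -> exists2 w, U w & `|w - z| < r.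
Proof.
move=> r0 yr yU; pose a (t : R) := y + t *: (z - y).
have ca : continuous a by rewrite /a; continuity.
have a0 : a 0 = y by rewrite /a scale0r addr0.
have : \forall t \near (0 : R), U (a t) by apply: ca; rewrite a0.
move=> /nbhs_ballP[e /= e0 eU]; pose t := Num.min (e / 2) 1.
have t0 : 0 < t by rewrite lt_min ltr01 divr_gt0.
have t1 : t <= 1 by rewrite ge_min lexx orbT.
exists (a t).
  apply: eU; rewrite /ball /= sub0r normrN gtr0_norm //.
  by rewrite gt_min ltr_pdivrMr // ltr_pMr // ltr1n.
have -> : a t - z = (1 - t) *: (y - z).
  by rewrite /a -[z - y]opprB scalerN addrAC scalerBl scale1r.
rewrite normrZ ger0_norm ?subr_ge0//.
by apply: (@le_lt_trans _ _ ((1 - t) * r)); [rewrite ler_wpM2l// subr_ge0|nra].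
Qed.

(** The path is constant before 0, as required of the arc of a translation
    chain, and is at x at time 1/2. *)
Definition broken_line (p x q : R * R) (t : R) : R * R :=
  p + clamp (2 * t) *: (x - p) + clamp (2 * t - 1) *: (q - x).

Lemma clamp01 (t : R) : 0 <= t <= 1 -> clamp t = t.
Proof. by move=> /andP[t0 t1]; rewrite /clamp (min_idPl t1) (max_idPr t0). Qed.
Lemma clamp0 (t : R) : t <= 0 -> clamp t = 0.
Proof. by move=> t0; rewrite /clamp; apply/max_idPl; rewrite ge_min t0. Qed.
Lemma clamp1 (t : R) : 1 <= t -> clamp t = 1.
Proof. by move=> t1; rewrite /clamp (min_idPr t1); apply/max_idPr. Qed.

Lemma broken_line_cont p x q : continuous (broken_line p x q).
Proof. by rewrite /broken_line /clamp; continuity. Qed.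
Lemma broken_line0 p x q t : t <= 0 -> broken_line p x q t = p.
Proof. by move=> t0; rewrite /broken_line !clamp0 ?scale0r ?addr0//; lra. Qed.
Lemma broken_line1 p x q : broken_line p x q 1 = q.
Proof.
rewrite /broken_line !clamp1; [|lra|lra].
by rewrite !scale1r [p + _]addrC subrK addrC subrK.
Qed.
Lemma broken_line_half p x q : broken_line p x q (2^-1) = x.
Proof.
rewrite /broken_line divff // clamp1 // clamp0 ?subrr // scale0r scale1r addr0.
by rewrite addrC subrK.
Qed.

Lemma broken_line_in p x q z (r t : R) : `|p - z| <= r -> `|x - z| < r ->
  `|q - z| <= r -> 0 < t < 1 -> `|broken_line p x q t - z| < r.
Proof.
move=> pr xr qr /andP[t0 t1].
have seg u v (l : R) : `|u - z| <= r -> `|v - z| < r -> 0 < l <= 1 ->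
    `|u + l *: (v - u) - z| < r.
  move=> ur vr /andP[l0 l1].
  have -> : u + l *: (v - u) - z = (1 - l) *: (u - z) + l *: (v - z).
    rewrite scalerBl scale1r -[RHS]addrA [- _ + _]addrC -scalerBr.
    by rewrite opprB addrA subrK addrAC.
  apply: le_lt_trans (ler_normD _ _) _.
  rewrite [X in X + _]normrZ [X in _ + X]normrZ (ger0_norm (ltW l0)) ger0_norm ?subr_ge0//.
  move: ur vr; move: `|u - z| `|v - z| => a b; nra.
rewrite /broken_line; have [th|th] := leP t 2^-1.
  rewrite (@clamp0 (2 * t - 1)); last by lra.
  rewrite scale0r addr0 clamp01; last by lra.
  by apply: seg => //; lra.
rewrite (@clamp1 (2 * t)); last by lra.
rewrite scale1r [p + _]addrC subrK clamp01; last by lra.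
have -> : x + (2 * t - 1) *: (q - x) = q + (2 - 2 * t) *: (x - q).
  rewrite -[x - q]opprB scalerN -scaleNr -{1}[x](subrK q) -{1}[x - q]opprB addrAC -scaleN1r -scalerDl addrC.
  by congr (_ + _ *: _); ring.
by apply: seg => //; lra.
Qed.

(** Brouwer's lemma on free discs.  In the maximal free square take the least n
    such that the open square meets its n-th image, or the touching point y has
    period n.  Below n the closed square does not meet the images of the open
    one, so a broken line from y to g (y) is a translation arc for g.  If y has
    period n, the chain closes up at y.  Otherwise the arc is taken through a
    point x that returns, and g is followed by a push taking the n-th image of x
    back to x; the push is supported in the square and creates no fixed point. *)
Lemma free_square_wandering (g gi : R * R -> R * R) K z s :
  continuous g -> continuous gi -> cancel g gi -> cancel gi g ->
  (forall w, `|g w - w| <= K) -> (forall w, g w <> w) ->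
  0 < s -> free_square g z s ->
  forall k, (0 < k)%N -> free_square (iter k g) z s.
Proof.
move=> cg cgi gK giK gB nofix s0 fs k0 k0_gt0 w0 w0s.
rewrite leNgt; apply/negP => ret.
have [r [y [sr fr yr gyr]]] := maximal_free_square cg gB s0 fs.
have r0 : 0 < r by exact: lt_le_trans sr.
pose Q k := (0 < k)%N /\ (iter k g y = y \/
   exists2 w, `|w - z| < r & `|iter k g w - z| < r).
have exQ : exists k, `[< Q k >].
  exists k0; apply/asboolP; split=> //; right; exists w0; exact: lt_le_trans sr.
have := ex_minnP exQ; case=> n /asboolP[n0 Qn] nmin.
have small k : (0 < k < n)%N -> iter k g y <> y /\
    (forall w, `|w - z| < r -> r <= `|iter k g w - z|).
  move=> /andP[kp kn]; have nQ : ~ Q k by move=> /asboolP/nmin; rewrite leqNgt kn.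
  split=> [E|w wr]; first by apply: nQ; split=> //; left.
  rewrite leNgt; apply/negP => h; apply: nQ; split=> //; right; by exists w.
have n2 : (2 <= n)%N.
  case: n n0 Qn {nmin small} => [|[|n]] // _ [/nofix//|[w wr]].
  by rewrite /= ltNge fr.
(* A preimage of the open square under an iterate is open, so meeting the closed
   square it also meets the open one; disj2 is the same for images, and uses the
   inverse. *)
have disj1 k w w' : (0 < k < n)%N -> `|w - z| < r -> `|w' - z| <= r ->
    w <> iter k g w'.
  move=> kn wr w'r E.
  have [|w'' /= w''r w''z] := @square_closure z w' r [set u | `|iter k g u - z| < r] r0 w'r.
    have cn : continuous (fun u => `|iter k g u - z|).
      have ci := cont_iter (k := k) cg; by continuity.
    apply: (cn w' [set t : R | t < r]); apply: lt_nbhsl; by rewrite -E.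
  by have [_ /(_ _ w''z)] := small _ kn; rewrite leNgt w''r.
have disj2 k w w' : (0 < k < n)%N -> `|w - z| < r -> `|w' - z| <= r ->
    w' <> iter k g w.
  move=> kn wr w'r E.
  have itK u : iter k g (iter k gi u) = u.
    by elim: (k) u => //= m IH u; rewrite -iterS iterSr giK IH.
  have itK' u : iter k gi (iter k g u) = u.
    by elim: (k) u => //= m IH u; rewrite -iterS iterSr gK IH.
  have [|w'' /= w''r w''z] := @square_closure z w' r [set u | `|iter k gi u - z| < r] r0 w'r.
    have cn : continuous (fun u => `|iter k gi u - z|).
      have ci := cont_iter (k := k) cgi; by continuity.
    apply: (cn w' [set t : R | t < r]); apply: lt_nbhsl; by rewrite E itK'.
  by have [_ /(_ _ w''r)] := small _ kn; rewrite itK leNgt w''z.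
have bl x t : `|x - z| < r -> 0 <= t < 1 -> `|broken_line y x (g y) t - z| <= r.
  move=> xr /andP[]; rewrite le_eqVlt => /predU1P[<- _|t0 t1].
    by rewrite broken_line0.
  by apply/ltW/broken_line_in; rewrite ?t0.
have sepal x k p q : `|x - z| < r -> (0 < k < n)%N -> 0 <= p < 1 -> 0 <= q < 1 ->
     broken_line y x (g y) p <> iter k g (broken_line y x (g y) q).
  move=> xr kn /andP[p0 p1] /andP[q0 q1].
  move: p0; rewrite le_eqVlt => /predU1P[<-|p0]; last first.
    by apply: disj1 => //; [apply: broken_line_in; rewrite ?p0|apply: bl => //; rewrite q0].
  move: q0; rewrite le_eqVlt => /predU1P[<-|q0]; last first.
    by apply: disj2 => //; [apply: broken_line_in; rewrite ?q0|apply: bl => //; rewrite lexx ltr01].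
  by rewrite !broken_line0 //; have [/nesym] := small _ kn.
have ig : injective g := can_inj gK.
case: Qn => [per|[x xr gxr]].
  have [|||w /nofix//] := @translation_chain_fixed_point _ g K n (broken_line y z (g y)) 0
     cg ig gB n2 (@broken_line_cont _ _ _) (fun u u0 => etrans (broken_line0 _ _ _ u0) (esym (broken_line0 _ _ _ (lexx _))))
     (etrans (congr1 g (broken_line0 _ _ _ (lexx _))) (esym (broken_line1 _ _ _))) _ _ _.
  - by rewrite lexx ltr01.
  - by rewrite broken_line0.
  - by move=> k p q; apply: sepal; rewrite subrr normr0.
have [phi [cphi iphi phix phid phiz]] := push gxr xr.
pose h w := phi (g w).
have hE k w : (k < n)%N -> `|w - z| <= r -> iter k h w = iter k g w.
  move=> + wr; elim: k => //= k IH kn; rewrite IH; last exact: ltnW.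
  rewrite /h -iterS phid // leNgt; apply/negP => gr.
  by apply: (disj1 k.+1 _ _ _ gr wr).
have [|||||w] := @translation_chain_fixed_point _ h (K + (r + r)) n (broken_line y x (g y)) 2^-1
     (cont_comp cphi cg) (inj_comp iphi ig) _ n2 (@broken_line_cont _ _ _) (fun u u0 => etrans (broken_line0 _ _ _ u0) (esym (broken_line0 _ _ _ (lexx _)))) _ _ _ _.
- move=> w; have -> : h w - w = (g w - w) + (phi (g w) - g w).
    by rewrite [RHS]addrC addrA subrK.
  apply: le_trans (ler_normD _ _) _; apply: lerD => //.
  have [gr|gr] := leP r `|g w - z|.
    by rewrite phid // subrr normr0; lra.
  have -> : phi (g w) - g w = (phi (g w) - z) - (g w - z) by rewrite opprB addrA subrK.
  apply: le_trans (ler_normB _ _) _; apply: lerD; apply: ltW => //; exact: phiz.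
- by rewrite broken_line1 broken_line0 // -[h y]/(iter 1 h y) hE.
- by lra.
- rewrite broken_line_half; case: (n) n2 hE gxr phix => // m m2 hE _ phix.
  by rewrite iterS hE ?(ltW xr) // /h -iterS.
- by move=> k p q kn p01 q01; rewrite hE; [exact: sepal|by case/andP: kn|exact: bl].
move=> hw; have [gr|gr] := leP r `|g w - z|.
  by apply: (nofix w); rewrite -{2}hw /h phid.
have := phiz _ gr; rewrite -/(h w) hw => /fr; by rewrite leNgt gr.
Qed.
End free_square.

(** * Lifts to the plane of torus maps isotopic to the identity *)

Section torus_lifts.
Context {R : realType}.
Implicit Types (x y w N : R * R) (z : T2 R) (f : T2 R -> T2 R) (ft F G : R * R -> R * R).

Lemma piK z : pi_T2 (repr z) = z.
Proof. exact: reprK. Qed.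

Lemma enorm_ge x : `|x| <= enorm x.
Proof.
rewrite [`|x|]/Num.Def.normr /= ge_max /enorm -[`|x.1|]sqrtr_sqr -[`|x.2|]sqrtr_sqr.
by apply/andP; split; rewrite ler_wsqrtr// ?real_normK ?num_real// ?lerDl ?lerDr sqr_ge0.
Qed.

Lemma enorm_le x : enorm x <= 2 * `|x|.
Proof.
have n1 : `|x.1| <= `|x| by rewrite le_max lexx.
have n2 : `|x.2| <= `|x| by rewrite le_max lexx orbT.
have n0 : 0 <= `|x| by [].
rewrite /enorm -[2 * _]ger0_norm ?mulr_ge0// -sqrtr_sqr ler_wsqrtr//.
rewrite -(real_normK (num_real x.1)) -(real_normK (num_real x.2)).
have := normr_ge0 x.1; have := normr_ge0 x.2.
by move: n1 n2 n0; move: `|x| `|x.1| `|x.2| => a b c; nra.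
Qed.

Lemma Z2_small N : N \in Z2 R -> `|N| < 1 -> N = 0.
Proof.
move=> /andP[/intrP[a Na] /intrP[b Nb]].
rewrite [`|N|]/Num.Def.normr /= gt_max Na Nb -!intr_norm !ltrz1 => /andP[a0 b0].
have {a0} a0 : a = 0 by lia.
have {b0} b0 : b = 0 by lia.
by apply: plane_eq; rewrite ?Na ?Nb ?a0 ?b0.
Qed.

Lemma pi_Z2 x N : N \in Z2 R -> pi_T2 (x + N) = pi_T2 x.
Proof. by move=> NZ; apply/pi_T2_eq; rewrite addrAC subrr add0r. Qed.

(** The projection is open: the saturation of an open set is a union of its
    lattice translates. *)
Lemma pi_T2_image_nbhs x (U : set (R * R)) : nbhs x U -> nbhs (pi_T2 x) (@pi_T2 R @` U).
Proof.
move=> xU; pose V := interior U.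
have oV : open (@pi_T2 R @` V : set (T2 R)).
  suff : open (@pi_T2 R @^-1` (@pi_T2 R @` V)) by [].
  rewrite openE => y /= [w Vw /pi_T2_eq wy].
  pose N := w - y.
  have ct : continuous (fun u : R * R => u + N) by continuity.
  have : nbhs (y + N) V.
    by rewrite /N addrC subrK; apply: open_nbhs_nbhs; split=> //; exact: open_interior.
  move=> hV; have nV := ct y _ hV; change (nbhs y (@pi_T2 R @^-1` (@pi_T2 R @` V))).
  apply: (@filterS _ (nbhs y) _ _ _ _ nV) => u /= Vu; exists (u + N) => //.
  exact: pi_Z2.
apply: (@filterS _ _ _ (@pi_T2 R @` V)).
  by move=> _ [w Vw <-]; exists w => //; exact: interior_subset.
by apply: open_nbhs_nbhs; split=> //; exists x.
Qed.

Definition equivariant F := forall x N, N \in Z2 R -> F (x + N) = F x + N.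

(** Equivariant lifts extend from a map to a uniformly close one: the small
    displacement d is chosen as a function on the torus, which makes the new lift
    equivariant by construction, and it is continuous because lattice points
    shorter than 1 vanish. *)
Lemma lift_perturbation (f1 f2 : T2 R -> T2 R) F : continuous f2 ->
  is_lift f1 F -> equivariant F ->
  (forall z, exists2 d, `|d| < 4^-1 & f2 z = f1 z + pi_T2 d) ->
  exists2 G, is_lift f2 G & equivariant G.
Proof.
move=> cf2 [cF lF] eF near12.
have [D DP] := choice (fun z => let: ex_intro2 d a b := near12 z in
  ex_intro (fun d => `|d| < 4^-1 /\ f2 z = f1 z + pi_T2 d) d (conj a b)).
pose G x := F x + D (pi_T2 x).
have lG x : pi_T2 (G x) = f2 (pi_T2 x).
  by rewrite pi_T2D lF (DP (pi_T2 x)).2.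
exists G; last by move=> x N NZ; rewrite /G eF // pi_Z2 // addrAC.
split=> // x; apply/cvgrPdist_lt => /= e e0.
(* The bound 1/4 on all four errors makes the lattice vector between G (y) and
   the nearby preimage w shorter than 1. *)
pose e' := Num.min e 4^-1.
have e'0 : 0 < e' by rewrite lt_min e0 /= invr_gt0 ltr0n.
have c1 : \forall y \near x, (@pi_T2 R @` ball (G x) e') (f2 (pi_T2 y)).
  have cc : continuous (fun y : R * R => f2 (pi_T2 y)).
    exact: (cont_comp cf2 (@pi_T2_continuous R)).
  by apply: cc; rewrite -lG; apply: pi_T2_image_nbhs; exact: nbhsx_ballx.
have c2 : \forall y \near x, `|F x - F y| < 4^-1.
  by have /cvgrPdist_lt := cF x; apply; rewrite invr_gt0 ltr0n.
near=> y.
have [w Gw piw] : (@pi_T2 R @` ball (G x) e') (f2 (pi_T2 y)) by near: y.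
have Fxy : `|F x - F y| < 4^-1 by near: y.
have Gw' : `|G x - w| < e' by move: Gw; rewrite -ball_normE.
have we : `|G x - w| < e by apply: lt_le_trans Gw' _; rewrite ge_min lexx.
suff -> : G y = w by [].
apply/eqP; rewrite -subr_eq0; apply/eqP/Z2_small.
  by apply/pi_T2_eq; rewrite lG piw.
have -> : G y - w = (G x - w) - (F x - F y) - D (pi_T2 x) + D (pi_T2 y).
  rewrite /G; apply: plane_eq => /=; ring.
have dx := (DP (pi_T2 x)).1; have dy := (DP (pi_T2 y)).1.
have we4 : `|G x - w| < 4^-1 by apply: lt_le_trans Gw' _; rewrite ge_min lexx orbT.
apply: le_lt_trans (ler_normD _ _) _.
have := ler_normB (G x - w - (F x - F y)) (D (pi_T2 x)).
have := ler_normB (G x - w) (F x - F y).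
lra.
Unshelve. all: by end_near. Qed.

Lemma Z2_valued_constant (u : R * R -> R * R) : continuous u ->
  (forall x, u x \in Z2 R) -> forall x y, u x = u y.
Proof.
move=> cu uZ x y; pose p (s : R) := u (x + s *: (y - x)).
have cp : continuous p by apply: (cont_comp cu); continuity.
have p0 : p 0 = u x by rewrite /p scale0r addr0.
have p1 : p 1 = u y by rewrite /p scale1r addrC subrK.
suff : p 1 = p 0 by rewrite p0 p1.
apply: (@unit_interval_chain _ (fun s => p s = p 0)) => // t _.
have : \forall s \near t, `|p t - p s| < 1.
  by have /cvgrPdist_lt := cp t; apply; exact: ltr01.
apply: filterS => s /Z2_small pst _.
have -> : p s = p t by apply/esym/eqP; rewrite -subr_eq0 pst// rpredB ?uZ.
by [].
Qed.

(** Continuity method along the isotopy: by compactness of the fundamental domain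
    nearby stages are uniformly close, so having an equivariant lift is a clopen
    condition on the time. *)
Lemma isotopic_to_id_lift f : isotopic_to_id f -> exists2 F, is_lift f F & equivariant F.
Proof.
move=> [H [cH hH H0 H1]].
pose Q (t : R) := exists2 F, is_lift (H t) F & equivariant F.
suff : Q 1 by rewrite /Q H1.
apply: unit_interval_chain; last first.
  by exists id; rewrite // H0; split=> //; exact: cont_id.
move=> t0 t01.
have cH' t x : 0 <= t <= 1 -> forall V, nbhs (H t (pi_T2 x)) V ->
    \forall p \near (t, x), 0 <= p.1 <= 1 -> V (H p.1 (pi_T2 p.2)).
  move=> t1 V HV.
  have := (subspace_continuousP _ _).1 cH (t, pi_T2 x).
  have At : (`[0, 1] `*` [set: T2 R]) (t, pi_T2 x) by split; rewrite //= in_itv.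
  move=> /(_ At) /(_ V HV); rewrite /within /= => W.
  have cp : continuous (fun p : R * (R * R) => (p.1, pi_T2 p.2)).
    apply: cont_pair; first by apply: cont_fst; exact: cont_id.
    apply: (cont_comp (@pi_T2_continuous R)); apply: cont_snd; exact: cont_id.
  have W2 := cp (t, x) _ W.
  apply: (@filterS _ (nbhs (t, x)) _ _ _ _ W2) => p /= + p01; apply.
  by split; rewrite //= in_itv.
have near0 : \forall t \near t0, [set w : R * R | 0 <= w.1 <= 1 /\ 0 <= w.2 <= 1] `<=`
    (fun x => 0 <= t <= 1 -> exists2 d, `|d| < 4^-1 & H t (pi_T2 x) = H t0 (pi_T2 x) + pi_T2 d).
  have cK : compact [set w : R * R | 0 <= w.1 <= 1 /\ 0 <= w.2 <= 1].
    have -> : [set w : R * R | 0 <= w.1 <= 1 /\ 0 <= w.2 <= 1] =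
        [set` `[0%R, 1%R]] `*` [set` `[0%R, 1%R]].
      by apply/seteqP; split=> w /=; rewrite !in_itv.
    by apply: compact_setX; exact: segment_compact.
  have := (compact_near_coveringP _).1 cK.
  move=> /(_ R (nbhs t0) (fun t x => 0 <= t <= 1 -> exists2 d, `|d| < 4^-1 & H t (pi_T2 x) = H t0 (pi_T2 x) + pi_T2 d)).
  apply=> x _.
  pose p0 := repr (H t0 (pi_T2 x)).
  pose V := @pi_T2 R @` ball p0 8^-1.
  have HV : nbhs (H t0 (pi_T2 x)) V.
    rewrite -[H t0 _]piK; apply: pi_T2_image_nbhs; apply: nbhsx_ballx; by rewrite invr_gt0.
  have n1 := cH' t0 x t01 V HV.
  have c1 : continuous (fun p : (R * R) * R => (p.2, p.1)).
    by apply: cont_pair; [apply: cont_snd|apply: cont_fst]; exact: cont_id.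
  have c2 : continuous (fun p : (R * R) * R => (t0, p.1)).
    by apply: cont_pair; [exact: cont_cst|apply: cont_fst; exact: cont_id].
  have n2 := c1 (x, t0) _ n1.
  have n3 := c2 (x, t0) _ n1.
  change (nbhs (x, t0) [set p : (R * R) * R | 0 <= p.2 <= 1 -> exists2 d, `|d| < 4^-1 &
    H p.2 (pi_T2 p.1) = H t0 (pi_T2 p.1) + pi_T2 d]).
  apply: (@filterS2 _ (nbhs (x, t0)) _ _ _ _ _ n2 n3) => -[x' t] /= /[swap] h3 + t1 => /(_ t1) [a Va <-].
  have [b Vb <-] := h3 t01.
  exists (a - b); last by rewrite pi_T2B addrCA subrr addr0.
  move: Va Vb; rewrite -!ball_normE /= => Va Vb.
  have -> : a - b = (p0 - b) - (p0 - a) by rewrite opprB [RHS]addrC addrA subrK.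
  by have := ler_normB (p0 - b) (p0 - a); lra.
apply: filterS near0 => t tP t1.
have full z : exists2 d, `|d| < 4^-1 & H t z = H t0 z + pi_T2 d.
  pose x := repr z; pose N : R * R := ((Num.floor x.1)%:~R, (Num.floor x.2)%:~R).
  have NZ : N \in Z2 R by rewrite /Z2 unfold_in /= !intr_int.
  have [|d d4 E] := tP (x - N) _ t1.
    rewrite /=; have := Num.Theory.floor_itv x.1; have := Num.Theory.floor_itv x.2.
    by rewrite !intrD => *; lra.
  exists d => //; move: E; rewrite -[z]piK -/x.
  by have -> : pi_T2 (x - N) = pi_T2 x by apply: pi_Z2; rewrite rpredN.
have cHt s : 0 <= s <= 1 -> continuous (H s).
  by move=> s01; have [] := hH s; rewrite // in_itv.
split=> -[F lF eF].
  apply: (lift_perturbation (cHt _ t01) lF eF) => z.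
  have [d d4 E] := full z; exists (- d); first by rewrite normrN.
  have pi0 : pi_T2 (d - d) = 0 by rewrite pi_T2B subrr.
  by rewrite E -addrA -pi_T2D pi0 addr0.
exact: (lift_perturbation (cHt _ t1) lF eF).
Qed.

(** Two lifts differ by a continuous, hence constant, lattice-valued map. *)
Lemma lift_equivariant f ft : isotopic_to_id f -> is_lift f ft -> equivariant ft.
Proof.
move=> /isotopic_to_id_lift [F [cF lF] eF] [cft lft].
have E : forall x y, ft x - F x = ft y - F y.
  apply: Z2_valued_constant; first by continuity.
  by move=> x; apply/pi_T2_eq; rewrite lft lF.
move=> x N NZ; have := E (x + N) x; rewrite eF // => /eqP.
rewrite subr_eq => /eqP ->.
by rewrite addrA subrK.
Qed.
End torus_lifts.

(** * Deviation, periodic points and Holder estimates upstairs *)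

Section lift_dynamics.
Context {R : realType}.
Implicit Types (x y w N v : R * R) (z : T2 R) (f : T2 R -> T2 R) (ft F G : R * R -> R * R).

Lemma lift_injective f ft : homeomorphism f -> is_lift f ft -> equivariant ft -> injective ft.
Proof.
move=> [_ [f' [_ fK _]]] [_ lft] eft x y E.
have : pi_T2 x = pi_T2 y by apply: (can_inj fK); rewrite -!lft E.
move=> /pi_T2_eq NZ; have := eft y _ NZ; rewrite [y + _]addrC subrK E.
by rewrite -[LHS]addr0 => /addrI /esym /eqP; rewrite subr_eq0 => /eqP.
Qed.

(** Local continuity of the inverse comes from the continuity of the inverse of f
    and the openness of the projection. *)
Lemma lift_inverse f ft : homeomorphism f -> is_lift f ft -> equivariant ft ->
  exists fi, [/\ continuous fi, cancel ft fi & cancel fi ft].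
Proof.
move=> hf lf eft; have ift := lift_injective hf lf eft.
have [cf [f' [cf' fK f'K]]] := hf; have [cft lft] := lf.
have /choice[fi fiK] : forall y, exists x, ft x = y.
  move=> y; pose x := repr (f' (pi_T2 y)).
  have NZ : y - ft x \in Z2 R by apply/pi_T2_eq; rewrite lft piK f'K.
  by exists (x + (y - ft x)); rewrite eft // addrC subrK.
exists fi; split=> //; last by move=> x; apply: ift; rewrite fiK.
move=> y; apply/cvgrPdist_lt => /= e e0.
pose U := [set u : R * R | `|fi y - u| < e /\ `|ft (fi y) - ft u| < 2^-1].
have nU : nbhs (fi y) U.
  apply: filterI; first by have := nbhsx_ballx (fi y) e e0; rewrite -ball_normE.
  by have /cvgrPdist_lt := cft (fi y); apply; rewrite invr_gt0.
have c1 : continuous (fun w : R * R => f' (pi_T2 w)).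
  exact: (cont_comp cf' (@pi_T2_continuous R)).
have : nbhs (f' (pi_T2 y)) (@pi_T2 R @` U).
  have -> : f' (pi_T2 y) = pi_T2 (fi y) by rewrite -{1}(fiK y) lft fK.
  exact: pi_T2_image_nbhs.
move=> hU; have nw := c1 y _ hU.
have nw2 : \forall w \near y, `|y - w| < 2^-1.
  have := nbhsx_ballx y 2^-1; rewrite -ball_normE; apply; by rewrite invr_gt0.
apply: (@filterS2 _ (nbhs y) _ _ _ _ _ nw nw2) => w /= [u [u1 u2] uw] yw.
suff -> : fi w = u by [].
apply: ift; rewrite fiK; apply/esym/eqP; rewrite -subr_eq0; apply/eqP/Z2_small.
  by apply/pi_T2_eq; rewrite lft uw f'K.
have -> : ft u - w = (y - w) - (ft (fi y) - ft u) by rewrite fiK opprB [RHS]addrC addrA subrK.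
by have := ler_normB (y - w) (ft (fi y) - ft u); lra.
Qed.

Lemma equivariant_iter ft k : equivariant ft -> equivariant (iter k ft).
Proof. by move=> eft x N NZ; elim: k => //= k ->; exact: eft. Qed.

Lemma pi_iter f ft k x : is_lift f ft -> pi_T2 (iter k ft x) = iter k f (pi_T2 x).
Proof. by move=> [_ lft]; elim: k => //= k IH; rewrite lft IH. Qed.

Lemma deviation_lift ft v (C delta : R) : equivariant ft -> has_deviation ft v C delta ->
  forall n x, (0 < n)%N ->
    `|iter n ft x - x - n%:R *: v| <= C * n%:R `^ delta.
Proof.
move=> eft dev n x n0; pose y := repr (pi_T2 x).
have yxZ : y - x \in Z2 R by apply/pi_T2_eq; rewrite piK.
have -> : iter n ft x - x = iter n ft y - y.
  rewrite -[y](subrK x) [y - x + x]addrC equivariant_iter //.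
  by rewrite opprD addrACA subrr addr0.
have nR : 0 < n%:R :> R by rewrite ltr0n.
have : ((Delta_at ft v n (pi_T2 x))%:E <= (C * n%:R `^ (delta - 1))%:E)%E.
  apply: le_trans (dev n n0).
  apply: (@le_trans _ _ (ereal_sup [set (Delta_at ft v n z)%:E | z in [set: T2 R]])).
    by apply: ereal_sup_ubound; exists (pi_T2 x).
  by apply: ereal_sup_ubound; exists n => /=.
rewrite lee_fin /Delta_at -/y => H.
have {}H := le_trans (enorm_ge _) H.
have -> : iter n ft y - y - n%:R *: v = n%:R *: (n%:R^-1 *: (iter n ft y - y) - v).
  by rewrite scalerBr scalerA divff ?gt_eqF// scale1r.
rewrite normrZ gtr0_norm //.
have -> : C * n%:R `^ delta = n%:R * (C * n%:R `^ (delta - 1)).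
  have -> : n%:R `^ delta = n%:R `^ 1 * n%:R `^ (delta - 1).
    by rewrite -powRD ?(gt_eqF nR) ?implybT // addrC subrK.
  by rewrite powRr1 ?(ltW nR) // mulrCA.
by rewrite ler_pM2l.
Qed.

(** Such a point would put N / q in the rotation set. *)
Lemma no_periodic_point ft v q x N : equivariant ft -> rotation_set ft = [set v] ->
  ~ rational_vector v -> (0 < q)%N -> N \in Z2 R -> iter q ft x <> x + N.
Proof.
move=> eft rot irr q0 NZ E.
have E' k : iter (k * q) ft x = x + k%:R *: N.
  elim: k => [|k IH]; first by rewrite scale0r addr0.
  rewrite mulSn iterD IH equivariant_iter ?E //.
    by rewrite -addrA -{1}[N]scale1r -scalerDl nat1r.
  by rewrite scaler_nat rpredMn.
have : rotation_set ft (q%:R^-1 *: N).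
  exists (fun=> x), (fun i => i.+1 * q)%N; split.
    move=> A [m _ mA]; exists m => // i /= mi; apply: mA => /=.
    by rewrite (leq_trans mi) // (leq_trans (leqnSn _)) // leq_pmulr.
  have -> : (fun i => (i.+1 * q)%:R^-1 *: (iter (i.+1 * q) ft x - x)) =
      (fun=> (q%:R^-1 : R) *: N).
    apply: funext => i; rewrite E' addrAC subrr add0r scalerA natrM invfM.
    by rewrite mulrAC mulVf ?mul1r // pnatr_eq0.
  exact: cvg_cst.
rewrite rot => vE; apply: irr; rewrite -vE.
move: NZ => /andP[/intrP[a Na] /intrP[b Nb]].
by split; apply/rationalP; [exists a|exists b]; exists q; rewrite /= ?Na ?Nb /GRing.scale /= mulrC.
Qed.

Lemma tnorm_lt w (e : R) : tnorm (pi_T2 w) < e -> exists2 N, N \in Z2 R & enorm (w - N) < e.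
Proof.
rewrite tnorm_pi_T2 /plane_tnorm => we.
pose S := [set enorm (w - y) | y in [set` Z2 R]].
have hS : has_inf S.
  split; first by exists (enorm (w - 0)); exists 0 => //=; rewrite rpred0.
  by exists 0 => _ [y _ <-]; exact: sqrtr_ge0.
have e0 : 0 < e - inf S by rewrite subr_gt0.
have [_ [N NZ <-]] := inf_adherent e0 hS; rewrite [inf _ + _]addrC subrK => ?.
by exists N.
Qed.

Lemma tnorm_le w N : N \in Z2 R -> tnorm (pi_T2 w) <= enorm (w - N).
Proof.
move=> NZ; rewrite tnorm_pi_T2 /plane_tnorm; apply: ge_inf; last by exists N.
by exists 0 => _ [y _ <-]; exact: sqrtr_ge0.
Qed.

Lemma tnorm_le0 w : tnorm (pi_T2 w) <= enorm w.
Proof. by have := @tnorm_le w 0 (rpred0 _); rewrite subr0. Qed.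

Lemma tnorm_ge0 z : 0 <= tnorm z.
Proof.
rewrite -[z]piK leNgt; apply/negP => /tnorm_lt[N _].
by rewrite ltNge sqrtr_ge0.
Qed.

Lemma expRN2 : expR (- 2) <= 4^-1 :> R.
Proof.
rewrite expRN lef_pV2 ?posrE ?expR_gt0 //.
have e1 : 2 <= expR 1 :> R by have := expR_ge1Dx (1 : R); lra.
have -> : expR 2 = expR 1 * expR 1 :> R by rewrite -expRD; congr expR; lra.
nra.
Qed.

(** The Holder bound on the torus controls the lift once the two image points are
    known to be close in the plane; that follows along the segment from y to x,
    where the distance to the lattice stays below 1/4, so that the norm of the
    difference never crosses 1/2.  The logarithmic form with additive constant A
    is the one that iterates well. *)
Lemma holder_lift f ft (a : R) : 0 < a <= 1 -> is_lift f ft -> holder a f ->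
  exists A B : R, [/\ 0 <= A, 0 <= B & forall x y (u : R), u < - B ->
    `|x - y| <= expR u -> `|ft x - ft y| <= expR (A + a * u)].
Proof.
move=> /andP[a0 a1] [cft lft] [M0 Mh].
pose M := Num.max 1 (2 * M0); pose A := ln M.
have M1 : 1 <= M by rewrite le_max lexx.
have ME : expR A = M by rewrite lnK // posrE; lra.
have A0 : 0 <= A by exact: ln_ge0.
exists A, ((A + 2) / a); split=> //.
  by apply: divr_ge0; lra.
move=> x y u uB xyu.
have small : expR (A + a * u) < 4^-1.
  apply: lt_le_trans expRN2; rewrite ltr_expR.
  by move: uB; rewrite -mulNr ltr_pdivlMr // mulrC; lra.
pose p (s : R) := ft (y + s *: (x - y)) - ft y.
have cp : continuous p by rewrite /p; continuity.
have tp s : 0 <= s <= 1 -> tnorm (pi_T2 (p s)) <= expR (A + a * u).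
  move=> s01; rewrite /p pi_T2B !lft; apply: le_trans (Mh _ _) _.
  have td0 := tnorm_ge0 (pi_T2 (y + s *: (x - y)) - pi_T2 y).
  have td : tdist (pi_T2 (y + s *: (x - y))) (pi_T2 y) <= 2 * expR u.
    rewrite /tdist -pi_T2B; apply: le_trans (tnorm_le0 _) _.
    apply: le_trans (enorm_le _) _; rewrite ler_pM2l // addrAC subrr add0r.
    rewrite normrZ ger0_norm; last by lra.
    by have := normr_ge0 (x - y); nra.
  have tpw : tdist (pi_T2 (y + s *: (x - y))) (pi_T2 y) `^ a <= 2 * expR (a * u).
    have e0 := expR_gt0 u.
    have e2 : 0 <= 2 * expR u by lra.
    apply: le_trans (ge0_ler_powR (ltW a0) _ _ td) _; rewrite ?nnegrE //.
    rewrite powRM // ?expR_ge0 //.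
    have -> : expR u `^ a = expR (a * u) by rewrite /powR gt_eqF // expRK.
    by rewrite ler_pM2r ?expR_gt0 // ler1_powR // ler1n.
  have M0M : 2 * M0 <= M by rewrite le_max lexx orbT.
  rewrite expRD ME; have e0 := expR_gt0 (a * u).
  have := powR_ge0 (tdist (pi_T2 (y + s *: (x - y))) (pi_T2 y)) a.
  move: tpw; set X := _ `^ a; move=> tpw X0.
  have [M00|M00] := leP 0 M0; first by nra.
  have h1 : M0 * X <= 0 by nra.
  by apply: (le_trans h1); apply: mulr_ge0; lra.
have half s : 0 <= s <= 1 -> `|p s| < 2^-1 -> forall e, e <= 4^-1 ->
    tnorm (pi_T2 (p s)) < e -> `|p s| < e.
  move=> s01 ps e e4 /tnorm_lt[N NZ pN].
  have pN' := le_lt_trans (enorm_ge _) pN.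
  have N0 : N = 0.
    apply: Z2_small => //.
    have -> : N = p s - (p s - N) by rewrite opprB addrC subrK.
    by have := ler_normB (p s) (p s - N); lra.
  by move: pN'; rewrite N0 subr0.
have p1 : `|p 1| < 2^-1.
  apply: (@unit_interval_chain _ (fun s => `|p s| < 2^-1)); last first.
    by rewrite /p scale0r addr0 subrr normr0 invr_gt0.
  move=> t t01.
  have : \forall s \near t, `|p t - p s| < 4^-1.
    by have /cvgrPdist_lt := cp t; apply; rewrite invr_gt0.
  apply: filterS => s ts s01; split=> [h|h].
    have h4 := half s s01 h 4^-1 (lexx _) (le_lt_trans (tp s s01) small).
    have -> : p t = p s + (p t - p s) by rewrite addrC subrK.
    by have := ler_normD (p s) (p t - p s); lra.
  have h4 := half t t01 h 4^-1 (lexx _) (le_lt_trans (tp t t01) small).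
  have -> : p s = p t - (p t - p s) by rewrite opprB addrC subrK.
  by have := ler_normB (p t) (p t - p s); lra.
have -> : ft x - ft y = p 1 by rewrite /p scale1r addrC [y + _]addrC subrK addrC.
have I1 : 0 <= (1 : R) <= 1 by rewrite ler01 lexx.
rewrite leNgt; apply/negP => h.
have : `|p 1| < Num.min `|p 1| 4^-1.
  apply: (half 1 I1 p1); first by rewrite ge_min lexx orbT.
  by rewrite lt_min (le_lt_trans (tp 1 I1) h) (le_lt_trans (tp 1 I1) small).
by rewrite lt_min ltxx.
Qed.

Lemma holder_lift_iter ft (a A B : R) : 0 < a <= 1 -> 0 <= A -> 0 <= B ->
  (forall x y (u : R), u < - B ->
    `|x - y| <= expR u -> `|ft x - ft y| <= expR (A + a * u)) ->
  forall (q : nat) (u : R), q%:R * A + a ^+ q * u < - B -> u <= 0 -> 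
  forall x y, `|x - y| <= expR u ->
   `|iter q ft x - iter q ft y| <= expR (q%:R * A + a ^+ q * u).
Proof.
move=> /andP[a0 a1] A0 B0 H q; elim: q => [|q IH] u uB u0 x y xy.
  by rewrite mul0r add0r expr0 mul1r.
have an : 0 < a ^+ q by rewrite exprn_gt0.
have uB' : q%:R * A + a ^+ q * u < - B.
  apply: le_lt_trans uB; rewrite -natr1 exprS.
  have h : 0 <= (1 - a) * (a ^+ q * - u).
    by apply: mulr_ge0; [lra|apply: mulr_ge0; lra].
  by lra.
apply: le_trans (H _ _ _ uB' (IH u uB' u0 x y xy)) _.
rewrite ler_expR -natr1 exprS.
have qA : 0 <= (1 - a) * (q%:R * A).
  by apply: mulr_ge0; [lra|exact: mulr_ge0].
by lra.
Qed.
End lift_dynamics.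

(** * Area and recurrence *)

Section planar_measurability.
Context {R : realType}.

(** An open set of the plane is the countable union of the rational squares that
    it contains. *)
Lemma open_measurable_plane (O : set (R * R)) : open O -> measurable O.
Proof.
move=> oO; pose box (a b c : rat) : set (R * R) :=
  ball (ratr a : R) (ratr c : R) `*` ball (ratr b : R) (ratr c : R).
pose S a b c := if `[< box a b c `<=` O >] then box a b c else set0.
have -> : O = \bigcup_(a : rat) \bigcup_(b : rat) \bigcup_(c : rat) S a b c.
  apply/seteqP; split=> w.
    move=> Ow; have : nbhs w O by apply: open_nbhs_nbhs.
    move=> /nbhs_ballP[e /= e0 eO].
    have [c ce] := @rat_in_itvoo R 0 (e / 2) (divr_gt0 e0 (ltr0Sn _ _)).
    move: ce; rewrite in_itv /= => /andP[c0 ce].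
    have [a aw] : exists a : rat, ratr a \in `]w.1 - ratr c, w.1 + ratr c[.
      by apply: rat_in_itvoo; lra.
    have [b bw] : exists b : rat, ratr b \in `]w.2 - ratr c, w.2 + ratr c[.
      by apply: rat_in_itvoo; lra.
    exists a => //; exists b => //; exists c => //; rewrite /S.
    have ws : box a b c w.
      by rewrite /box /=; split; rewrite /ball /= ltr_distl; move: aw bw; rewrite !in_itv /=; lra.
    rewrite ifT //; apply/asboolP => u [u1 u2]; apply: eO.
    move: ws u1 u2 => [/=]; rewrite /ball /= !ltr_distl => w1 w2 u1 u2.
    change (ball w.1 e u.1 /\ ball w.2 e u.2); rewrite /ball /= !ltr_distl.
    by split; lra.
  by move=> [a _ [b _ [c _]]]; rewrite /S; case: asboolP => // h /h.
apply: bigcupT_measurable_rat => a; apply: bigcupT_measurable_rat => b.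
apply: bigcupT_measurable_rat => c; rewrite /S; case: ifP => // _.
by apply: measurableX; exact: measurable_realfun.measurable_ball.
Qed.

End planar_measurability.

Section overlap.
Local Open Scope ereal_scope.
Context d (X : measurableType d) (R : realType) (mu : {measure set X -> \bar R}).

Lemma measure_big_setU_le (I : Type) (r : seq I) (F : I -> set X) :
  (forall i, measurable (F i)) ->
  mu (\big[setU/set0]_(i <- r) F i) <= \sum_(i <- r) mu (F i).
Proof.
move=> mF; elim: r => [|i r IH]; first by rewrite !big_nil measure0.
rewrite !big_cons.
have mU : measurable (\big[setU/set0]_(j <- r) F j) by exact: bigsetU_measurable.
by apply: (le_trans (measureU2 mu (mF i) mU)); rewrite leeD2l.
Qed.

(** Exchanging the order of summation: for each label c the pieces F i c are
    disjoint in Q, so each label contributes at most 1. *)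
Lemma bounded_overlap (m : nat) (I : finType) (Q : set X) (E : 'I_m -> set X)
    (F : 'I_m -> I -> set X) :
  measurable Q -> mu Q <= 1 -> (forall i, measurable (E i)) ->
  (forall i c, measurable (F i c)) ->
  (forall i c, F i c `<=` Q) ->
  (forall i, E i `<=` \big[setU/set0]_(c : I) F i c) ->
  (forall c, trivIset setT (F ^~ c)) ->
  \sum_(i < m) mu (E i) <= (#|I|%:R)%:E.
Proof.
move=> mQ Q1 mE mF FQ EF tF.
apply: (@le_trans _ _ (\sum_(i < m) \sum_(c : I) mu (F i c))).
  apply: lee_sum => i _; apply: le_trans (measure_big_setU_le _ _) => //.
  by apply: le_measure => //; rewrite inE //; exact: bigsetU_measurable.
rewrite exchange_big /=.
apply: (@le_trans _ _ (\sum_(c : I) 1)); last by rewrite sumEFin sumr_const.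
apply: lee_sum => c _; rewrite -measure_bigsetU_ord //.
apply: le_trans Q1; apply: le_measure; rewrite ?inE //.
  exact: bigsetU_measurable.
by apply: (@big_ind _ (fun A => A `<=` Q)) => // A B AQ BQ x [/AQ|/BQ].
Qed.
End overlap.

Section torus_recurrence.
Context {R : realType}.
Implicit Types (x y w N v z : R * R) (f : T2 R -> T2 R) (ft F G : R * R -> R * R).

Lemma borel_open (V : set (T2 R)) : open V -> borel_T2 V.
Proof. by move=> oV; apply: sub_sigma_algebra. Qed.

Lemma area_iter f (V : set (T2 R)) : continuous f -> area_preserving f -> open V ->
  forall n, area (iter n f @^-1` V) = area V.
Proof.
move=> cf af oV; elim=> [|n IH]; first by congr (area _).
have -> : iter n.+1 f @^-1` V = f @^-1` (iter n f @^-1` V).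
  by apply/seteqP; split=> x /=; rewrite -iterS iterSr.
rewrite af //; apply: borel_open; apply: open_comp => // x _.
exact: cont_iter.
Qed.

Lemma pi_image_open (U : set (R * R)) : open U -> open (@pi_T2 R @` U : set (T2 R)).
Proof.
rewrite !openE => oU _ [x Ux <-]; apply: pi_T2_image_nbhs; exact: oU.
Qed.

Lemma open_square z (s : R) : open [set w : R * R | `|w - z| < s].
Proof.
have -> : [set w : R * R | `|w - z| < s] = ball z s.
  by rewrite -ball_normE; apply/seteqP; split=> w /=; rewrite distrC.
exact: ball_open.
Qed.

Lemma area_square z (s : R) : 0 <= z.1 < 1 -> 0 <= z.2 < 1 -> 0 < s <= 2^-1 ->
  ((s * s)%:E <= area (@pi_T2 R @` [set w | (`|w - z| < s)%R]))%E.
Proof.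
move=> z1 z2 s0.
have side (c : R) : 0 <= c < 1 -> exists b, forall t, b < t < b + s ->
    0 <= t < 1 /\ c - s < t < c + s.
  move=> c01; have [c2|c2] := ltP c 2^-1.
    by exists c => t; lra.
  by exists (c - s) => t; lra.
have [b1 B1] := side _ z1; have [b2 B2] := side _ z2.
have mI (b : R) : lebesgue_measure (`]b, (b + s)%R[%classic : set R) = s%:E.
  rewrite lebesgue_measure_itv /= lte_fin ifT; last by lra.
  by rewrite -EFinD; congr EFin; lra.
have -> : (s * s)%:E = (lebesgue_measure \x lebesgue_measure)%E
    (`]b1, (b1 + s)%R[%classic `*` `]b2, (b2 + s)%R[%classic : set (R * R)).
  by rewrite product_measure1E // EFinM; apply: (congr2 mule); apply/esym; exact: mI.
apply: le_measure; rewrite ?inE.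
- exact: measurableX.
- apply: measurableI; last exact: measurableX.
  apply: open_measurable_plane; apply: open_comp.
    by move=> x _; exact: pi_T2_continuous.
  by apply: pi_image_open; exact: open_square.
move=> w [/=]; rewrite !in_itv /= => /B1[t1 u1] /B2[t2 u2]; split=> //=.
exists w => //=; rewrite [`|_|]/Num.Def.normr /= gt_max !ltr_distl.
by rewrite u1 u2.
Qed.

Lemma shifted_ordinal (K : nat) (e : int) : `|e| < K ->
  exists c : 'I_(K.*2.+1), c%:R - K%:R = e%:~R :> R.
Proof.
move=> eK; have en : (absz (e + K%:Z)%R < K.*2.+1)%N by lia.
exists (Ordinal en) => /=; rewrite pmulrn.
have -> : (absz (e + K%:Z))%:Z = e + K%:Z by lia.
by rewrite intrD -pmulrn addrK.
Qed.

(** Sort the points of the i-th preimage of the square by the lattice vector c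
    that brings their image back to the square.  For a fixed c the preimages are
    disjoint, since a point common to two of them gives a return of the square to
    itself in the plane; so for each c their areas add up to at most 1. *)
Lemma square_recurrence f G (m : nat) z (s D : R) :
  continuous f -> area_preserving f -> (exists q, is_lift (iter q f) G) -> equivariant G ->
  0 <= z.1 < 1 -> 0 <= z.2 < 1 -> 0 < s <= 2^-1 ->
  (forall i x, (i < m)%N -> `|iter i G x - x| <= D) ->
  (forall k w, (0 < k < m)%N -> `|w - z| < s -> s <= `|iter k G w - z|) ->
  m%:R * (s * s) <= (2 * D + 7) ^+ 2.
Proof.
move=> cf af [q [cG lG]] eG z1 z2 s0 bG wand.
case: m bG wand => [|m0]; first by move=> _ _; rewrite mul0r sqr_ge0.
set m := m0.+1 => bG wand.
have D0 : 0 <= D by apply: le_trans (bG 0%N 0 isT).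
(* Points of the fundamental domain move by at most D, so D + 2 bounds the
   lattice vectors that occur; their coordinates are indexed by 'I_n after a
   shift by K. *)
pose K := (Num.truncn D + 3)%N; pose n := K.*2.+1.
pose U := @pi_T2 R @` [set w | (`|w - z| < s)%R].
have oU : open U by apply: pi_image_open; exact: open_square.
pose Q : set (R * R) := `[0, 1[%classic `*` `[0, 1[%classic.
have mQ : measurable Q by exact: measurableX.
pose nv (c : 'I_n * 'I_n) : R * R := ((c.1%:R - K%:R), (c.2%:R - K%:R)).
have nvZ c : nv c \in Z2 R.
  by rewrite /nv /Z2 unfold_in /= !rpredB // natr_int.
pose E (i : 'I_m) := @pi_T2 R @^-1` (iter i (iter q f) @^-1` U) `&` Q.
pose F (i : 'I_m) c : set (R * R) := [set x | `|iter i G x - (z + nv c)| < s] `&` Q.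
pose mu := (lebesgue_measure \x lebesgue_measure)%E : {measure set (measurableTypeR R * measurableTypeR R) -> \bar R}.
have cFq : continuous (iter q f) by exact: cont_iter.
have areaE i : mu (E i) = area U.
  rewrite -(area_iter cf af oU (i * q)); congr area.
  by apply/seteqP; split=> x /=; rewrite iterM.
have muQ : (mu Q <= 1)%E.
  have -> : mu Q = (lebesgue_measure (`[0%R, 1%R[%classic : set R) *
      lebesgue_measure (`[0%R, 1%R[%classic : set R))%E by exact: product_measure1E.
  by rewrite lebesgue_measure_itv /= lte_fin ltr01 oppr0 adde0 mul1e.
have mE i : measurable (E i).
  apply: measurableI => //; apply: open_measurable_plane.
  apply: open_comp; first by move=> x _; exact: pi_T2_continuous.
  by apply: open_comp => // x _; exact: cont_iter.
have mF i c : measurable (F i c).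
  apply: measurableI => //; apply: open_measurable_plane.
  by apply: (open_comp (D := [set w | `|w - (z + nv c)| < s])) => [x _|]; [exact: cont_iter|exact: open_square].
have EF i : E i `<=` \big[setU/set0]_(c : 'I_n * 'I_n) F i c.
  move=> x [/=]; rewrite -(pi_iter _ _ (conj cG lG)) => -[w ws /pi_T2_eq NZ] Qx.
  have [c cE] : exists c, nv c = iter i G x - w.
    move: NZ; rewrite -rpredN opprB.
    move=> /[dup] NZ /andP[/intrP[a Na] /intrP[b Nb]].
    have Nle : `|iter i G x - w| <= D + 2.
      have -> : iter i G x - w = (iter i G x - x) + (x - z) - (w - z).
        by rewrite addrA subrK opprB addrA subrK.
      have xz : `|x - z| <= 1.
        move: Qx => [/=]; rewrite !in_itv /= => x1 x2.
        by rewrite [`|_|]/Num.Def.normr /= ge_max !ler_distl; lra.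
      have := ler_normB (iter i G x - x + (x - z)) (w - z).
      have := ler_normD (iter i G x - x) (x - z).
      by have := bG i x (ltn_ord i); move: ws => /=; lra.
    have DK : D + 2 < K%:R.
      by have := truncnS_gt D; rewrite /K natrD -natr1; lra.
    have bnd (e : int) : `|e%:~R : R| < K%:R -> exists c : 'I_n, c%:R - K%:R = e%:~R :> R.
      by rewrite -intr_norm pmulrn ltr_int; exact: shifted_ordinal.
    have N1 : `|(iter i G x - w).1| <= `|iter i G x - w| by rewrite le_max lexx.
    have N2 : `|(iter i G x - w).2| <= `|iter i G x - w| by rewrite le_max lexx orbT.
    have [|c1 c1E] := bnd a; first by rewrite -Na; lra.
    have [|c2 c2E] := bnd b; first by rewrite -Nb; lra.
    by exists (c1, c2); rewrite /nv /= c1E c2E -Na -Nb; case: (_ - _).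
  have Fx : F i c x.
    split=> //=; rewrite cE; move: ws => /=.
    have -> // : iter i G x - (z + (iter i G x - w)) = w - z.
    by apply: plane_eq => /=; ring.
  by rewrite (bigD1 c) //=; left.
have tF c : trivIset setT (F ^~ c).
  move=> i j _ _ [x [[/= Fi Qx] [/= Fj _]]]; apply/eqP.
  wlog ij : i j Fi Fj / (i < j)%N.
    move=> W; case: (ltngtP i j) => h; last by apply/eqP/val_inj.
    - exact: W Fi Fj h.
    - by rewrite eq_sym; exact: W Fj Fi h.
  exfalso.
  have ji : (0 < j - i < m)%N by rewrite subn_gt0 ij (leq_ltn_trans (leq_subr _ _)).
  have := wand _ (iter i G x - nv c) ji.
  have eN u k : iter k G (u - nv c) = iter k G u - nv c.
    by apply: equivariant_iter => //; rewrite rpredN.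
  have re y : y - nv c - z = y - (z + nv c) by rewrite opprD addrA addrAC.
  rewrite eN -iterD subnK ?(ltnW ij)// !re => /(_ Fi).
  by rewrite leNgt Fj.
have := bounded_overlap (mu := mu) mQ muQ mE mF (fun i c => @subIsetr _ _ _) EF tF.
rewrite (eq_bigr (fun=> area U)); last by move=> i _; rewrite areaE.
have := area_square z1 z2 s0; rewrite -/U.
move=> sU; rewrite card_prod !card_ord => le_n.
have : ((m%:R * (s * s))%:E <= (n * n)%:R%:E)%E.
  apply: le_trans le_n.
  have -> : (m%:R * (s * s))%:E = (\sum_(i < m) (s * s)%:E)%E.
    by rewrite sumEFin sumr_const card_ord mulr_natl.
  by apply: lee_sum.
rewrite lee_fin => /le_trans; apply.
have nD : n%:R <= 2 * D + 7 :> R.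
  have := truncn_itv D0 => /andP[tD _].
  by rewrite /n /K -natr1 -mul2n natrM natrD; lra.
by rewrite natrM expr2; apply: ler_pM.
Qed.
End torus_recurrence.

(** * The main estimate *)

Section estimate.
Context {R : realType}.
Implicit Types (x y w N v z : R * R) (f : T2 R -> T2 R) (ft F G : R * R -> R * R).

Lemma limn_einf_Ny (u : nat -> \bar R) : limn_einf u = -oo%E ->
  forall (K : R) n0, exists2 n, (n0 <= n)%N & (u n < K%:E)%E.
Proof.
move=> uoo K n0; apply: contrapT => H.
have Hu n : (n0 <= n)%N -> (K%:E <= u n)%E.
  by move=> nn; rewrite leNgt; apply/negP => h; apply: H; exists n.
have : (K%:E <= limn_einf u)%E.
  have -> : limn_einf u = ereal_sup (range (einfs u)).
    by rewrite limn_einf_lim; apply/cvg_lim => //; exact: cvg_einfs_sup.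
  apply: le_trans (ereal_sup_ubound (x := einfs u n0) _); last by exists n0.
  by apply: le_ereal_inf_tmp => _ [n /= nn <-]; exact: Hu.
by rewrite uoo leeNy_eq.
Qed.

Lemma lift_minus_iter ft p k x : equivariant ft -> p \in Z2 R ->
  iter k (fun x => ft x - p) x = iter k ft x - k%:R *: p.
Proof.
move=> eft pZ; elim: k => [|k IH]; first by rewrite scale0r subr0.
have kp : - (k%:R *: p) \in Z2 R by rewrite rpredN scaler_nat rpredMn.
rewrite !iterS IH eft // -addrA -opprD; congr (_ - _).
by rewrite -natr1 scalerDl scale1r.
Qed.

(** Taking logarithms leaves a factor 1 - 2 delta in front of ln M, which is
    where delta < 1/2 is needed; Q stands for q and al for a^q. *)
Lemma recurrence_rate (C delta L al eps Q M : R) :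
  0 <= delta < 2^-1 -> 0 < C -> 0 < al <= 1 -> 4 <= L -> 1 <= Q ->
  eps^-1 < M -> 0 < eps < 1 ->
  M * (expR (- (L * Q / al)) * expR (- (L * Q / al)))
    <= ((2 * C + 15) * (M * Q) `^ delta) ^+ 2 ->
  al * - ln eps <= (2 * ln (2 * C + 15) + 1 + 2 * L) / (1 - 2 * delta) * Q.
Proof.
move=> d0 C0 /andP[al0 al1] L4 Q1 eM /andP[eps0 eps1] key.
have V1 : 1 < eps^-1 by rewrite -invr1 ltf_pV2 ?posrE.
have M0 : 0 < M by lra.
have Q0 : 0 < Q by lra.
have C15 : 0 < 2 * C + 15 by lra.
have Y0 : 0 < (M * Q) `^ delta by apply: powR_gt0; exact: mulr_gt0.
move: key; rewrite -ler_ln ?posrE; last 2 first.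
- by rewrite !mulr_gt0 ?expR_gt0.
- by rewrite exprn_gt0 // mulr_gt0.
rewrite lnXn ?mulr_gt0 // !lnM ?posrE ?mulr_gt0 ?expR_gt0 // !expRK.
rewrite ln_powR lnM ?posrE // mulr2n.
have lnQ : ln Q <= Q - 1.
  by have := @le_ln1Dx R (Q - 1); rewrite addrCA subrr addr0; apply; lra.
have lnQ0 : 0 <= ln Q by exact: ln_ge0.
have lnM : - ln eps < ln M by rewrite -lnV ?posrE // ltr_ln ?posrE // invr_gt0.
have c0 : 0 <= ln (2 * C + 15) by apply: ln_ge0; lra.
have alu : al * (L * Q / al) = L * Q by rewrite mulrCA divff ?mulr1 // gt_eqF.
move: alu lnQ lnQ0 lnM c0; clear - d0 al0 al1 L4 Q1.
move: (ln Q) (ln M) (ln eps) (ln (2 * C + 15)) (L * Q / al) => lq l le c u alu lnQ lnQ0 lM c0 ineq.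
have dd : 0 < 1 - 2 * delta by lra.
rewrite mulrAC ler_pdivlMr // leNgt; apply/negP => far.
have b0 : 0 <= (1 - 2 * delta) * lq by apply: mulr_ge0; lra.
have b1 : 2 * delta * lq <= Q by lra.
have b2 : (1 - 2 * delta) * l <= 2 * c + Q + 2 * u by lra.
have b3 : (1 - 2 * delta) * - le < (1 - 2 * delta) * l by rewrite ltr_pM2l.
have b4 : al * ((1 - 2 * delta) * - le) <= al * (2 * c + Q + 2 * u).
  by rewrite ler_pM2l //; lra.
have b5 : al * (2 * c + Q) <= 1 * (2 * c + Q) by rewrite ler_wpM2r //; lra.
have b6 : 0 <= c * (Q - 1) by apply: mulr_ge0; lra.
lra.
Qed.

(** A point displaced further than exp (- q) would have a free neighbourhood,
    which cannot return by Brouwer's lemma and must return by area. *)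
Lemma near_return_displacement f ft v (a C delta A B : R) (q : nat) p :
  0 < a <= 1 -> 0 < C -> 0 <= delta < 2^-1 -> area_preserving f ->
  homeomorphism f -> is_lift f ft -> equivariant ft ->
  rotation_set ft = [set v] -> ~ rational_vector v ->
  (forall n x, (0 < n)%N -> `|iter n ft x - x - n%:R *: v| <= C * n%:R `^ delta) ->
  0 <= A -> 0 <= B ->
  (forall x y (u : R), u < - B ->
    `|x - y| <= expR u -> `|ft x - ft y| <= expR (A + a * u)) ->
  (0 < q)%N -> p \in Z2 R ->
  forall eps : R, 0 < eps < 1 -> `|q%:R *: v - p| <= 2 * eps ->
  (2 * ln (2 * C + 15) + 1 + 2 * (A + B + 4)) / (1 - 2 * delta) * q%:R
     < a ^+ q * - ln eps ->
  forall z, `|iter q ft z - p - z| <= expR (- q%:R).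
Proof.
have box_le (b c : R) : 0 < b -> 1 <= c ->
    (2 * (b + 4) + 7) ^+ 2 <= (2 * b + 15 * c) ^+ 2.
  by move=> b0 c1; rewrite ler_sqr ?nnegrE; lra.
move=> a01 C0 d0 af hf lf eft rot irr devx A0 B0 HA q0 pZ eps eps01 qvp Kq z0.
have qR : 1 <= q%:R :> R by rewrite ler1n.
have aq01 : 0 < a ^+ q <= 1.
  by rewrite exprn_gt0 ?exprn_ile1; lra.
have [aq0 aq1] := andP aq01.
pose g x := iter q ft x - p.
have eg : equivariant g.
  by move=> x N NZ; rewrite /g equivariant_iter // addrAC.
rewrite leNgt; apply/negP => far0.
(* By equivariance the far point may be taken in the fundamental domain. *)
pose N : R * R := ((Num.floor z0.1)%:~R, (Num.floor z0.2)%:~R).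
have NZ : N \in Z2 R by rewrite /Z2 unfold_in /= !intr_int.
pose z := z0 - N.
have z01 : 0 <= z.1 < 1.
  by have := Num.Theory.floor_itv z0.1; rewrite intrD /z /=; lra.
have z02 : 0 <= z.2 < 1.
  by have := Num.Theory.floor_itv z0.2; rewrite intrD /z /=; lra.
have far : expR (- q%:R) < `|g z - z|.
  have -> : g z - z = g z0 - z0.
    by rewrite /z eg ?rpredN // opprB addrA subrK.
  exact: far0.
clear far0.
have cft : continuous ft by case: lf.
have [fi [cfi ftK fiK]] := lift_inverse hf lf eft.
have cq : continuous (iter q ft) by exact: cont_iter.
have cfiq : continuous (iter q fi) by exact: cont_iter.
have itK (h h' : R * R -> R * R) k : cancel h h' -> cancel (iter k h) (iter k h').
  by move=> hK; elim: k => // k IH x; rewrite iterSr iterS hK IH.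
have cg : continuous g by rewrite /g; continuity.
pose gi y := iter q fi (y + p).
have cgi : continuous gi by rewrite /gi; continuity.
have gK : cancel g gi by move=> x; rewrite /g /gi subrK itK.
have giK : cancel gi g by move=> x; rewrite /g /gi itK // addrK.
have gitE k x : iter k g x = iter (k * q) ft x - k%:R *: p.
  by rewrite lift_minus_iter //; [rewrite iterM|exact: equivariant_iter].
have gdisp k x : (0 < k)%N ->
    `|iter k g x - x| <= C * (k * q)%:R `^ delta + k%:R * (2 * eps).
  move=> k0; rewrite gitE.
  have -> : iter (k * q) ft x - k%:R *: p - x =
      (iter (k * q) ft x - x - (k * q)%:R *: v) + k%:R *: (q%:R *: v - p).
    by apply: plane_eq => /=; rewrite /GRing.scale /= natrM; ring.
  apply: le_trans (ler_normD _ _) _; apply: lerD; first by rewrite devx // muln_gt0 k0.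
  by rewrite normrZ ger0_norm // ler_wpM2l.
have nofix w : g w <> w.
  move=> E; apply: (@no_periodic_point _ ft v q w p eft rot irr q0 pZ).
  by rewrite -{2}E /g subrK.
pose L := A + B + 4.
pose u := - (L * q%:R / a ^+ q).
have L4 : 4 <= L by rewrite /L; lra.
have Lq : 4 <= L * q%:R by nra.
have uE : a ^+ q * u = - (L * q%:R).
  by rewrite /u mulrN mulrCA divff ?mulr1 // gt_eqF.
have uL : u <= - (L * q%:R).
  by rewrite /u lerN2 ler_pdivlMr //; nra.
have u0 : u <= 0 by lra.
have uB : q%:R * A + a ^+ q * u < - B.
  by rewrite uE /L; nra.
pose s := expR u.
have q4 : expR (- (4 * q%:R)) <= expR (- q%:R) * 4^-1 :> R.
  apply: (@le_trans _ _ (expR (- q%:R) * expR (- 2))).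
    by rewrite -expRD ler_expR; lra.
  by rewrite ler_pM2l ?expR_gt0 // expRN2.
have eq1 : expR (- q%:R) <= 1 :> R by rewrite -[X in _ <= X]expR0 ler_expR; lra.
have s4 : s <= expR (- q%:R) * 4^-1.
  by apply: le_trans q4; rewrite /s ler_expR; nra.
have s0 : 0 < s by exact: expR_gt0.
have eq0 := expR_gt0 (- q%:R : R).
have s01 : 0 < s <= 2^-1 by rewrite s0 /=; lra.
(* The half-side s makes the image of the square much smaller than the
   displacement of its centre. *)
have free : free_square g z s.
  move=> w wz.
  have gwz : `|g w - g z| <= expR (- q%:R) * 4^-1.
    have -> : g w - g z = iter q ft w - iter q ft z by rewrite /g opprB addrA subrK.
    apply: le_trans q4; apply: le_trans (holder_lift_iter a01 A0 B0 HA uB u0 (ltW wz)) _.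
    by rewrite ler_expR uE /L; nra.
  have := ler_normB (g w - z) (g w - g z).
  have -> : g w - z - (g w - g z) = g z - z.
    by move: (g w) (g z) => b c; apply: plane_eq => /=; ring.
  by lra.
have wand := free_square_wandering cg cgi gK giK (fun w => gdisp 1%N w isT) nofix s0 free.
(* The longest time during which the mean drift m eps stays bounded. *)
pose m := (Num.truncn eps^-1).+1.
have em : eps^-1 < m%:R by exact: truncnS_gt.
have [e0 e1] : 0 < eps /\ eps < 1 by case/andP: eps01.
have me : m%:R * eps <= 2.
  have /andP[t1 _] : (Num.truncn eps^-1)%:R <= eps^-1 < m%:R.
    by apply: truncn_itv; rewrite invr_ge0 ltW.
  rewrite /m -natr1 mulrDl mul1r.
  have : (Num.truncn eps^-1)%:R * eps <= eps^-1 * eps by rewrite ler_pM2r.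
  by rewrite mulVf ?gt_eqF //; lra.
have m1 : 1 <= m%:R :> R by rewrite ler1n.
pose Y : R := (m * q)%:R `^ delta.
have mq1 : 1 <= (m * q)%:R :> R by rewrite ler1n muln_gt0 q0.
have Y1 : 1 <= Y.
  by rewrite -(powRr0 (m * q)%:R); apply: ler_powR => //; case/andP: d0.
have disp i x : (i < m)%N -> `|iter i g x - x| <= C * Y + 4.
  case: i => [_|i im]; first by rewrite subrr normr0; nra.
  apply: le_trans (gdisp i.+1 x isT) _; apply: lerD.
    rewrite ler_pM2l //; apply: ge0_ler_powR; rewrite ?nnegrE //; first by lra.
    by rewrite ler_nat leq_mul2r (ltnW im) orbT.
  have : i.+1%:R <= m%:R :> R by rewrite ler_nat ltnW.
  nra.
have lg : is_lift (iter q f) g.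
  split=> // x; rewrite /g -(pi_iter _ _ lf) -[LHS]/(pi_T2 (iter q ft x - p)).
  by apply: pi_Z2; rewrite rpredN.
have cf : continuous f by case: hf.
have := square_recurrence cf af (ex_intro _ q lg) eg z01 z02 s01 disp.
move=> /(_ (fun k w km => wand k (proj1 (andP km)) w)) key.
have key2 : m%:R * (s * s) <= ((2 * C + 15) * (m%:R * q%:R) `^ delta) ^+ 2.
  rewrite -natrM -/Y.
  have CY : 0 < C * Y by apply: mulr_gt0 => //; lra.
  have -> : (2 * C + 15) * Y = 2 * (C * Y) + 15 * Y by ring.
  by apply: le_trans key _; exact: box_le.
have := recurrence_rate d0 C0 aq01 L4 qR em eps01 key2.
by rewrite leNgt Kq.
Qed.
End estimate.

Theorem theorem1 (R : realType) (a C delta : R)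
    (f : T2 R -> T2 R) (ft : R * R -> R * R) (v : R * R) :
  0 < a <= 1 -> 0 < C -> 0 <= delta < 2^-1 ->
  area_preserving f ->
  irrational_pseudo_rotation f ft v ->
  holder a f ->
  limn_einf (fun n : nat =>
    (n%:R^-1 * a ^+ n * ln (tnorm (pi_T2 v *+ n)))%:E) = -oo%E ->
  has_deviation ft v C delta ->
  C0_rigid_exp f.
Proof.
move=> a01 C0 d0 af [[hf isof lf rot] irr] hol liou dev.
have eft := lift_equivariant isof lf.
have [A [B [A0 B0 HA]]] := holder_lift a01 lf hol.
have devx := deviation_lift eft dev.
pose K := (2 * ln (2 * C + 15) + 1 + 2 * (A + B + 4)) / (1 - 2 * delta).
have K0 : 0 < K.
  by apply: divr_gt0; [have := @ln_ge0 R (2 * C + 15); lra|lra].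
pose good (q : nat) := (0 < q)%N /\ dC0 (iter q f) id <= 2 * expR (- 1 * q%:R).
have goods n0 : exists q, (n0 <= q)%N /\ good q.
  have [q nq uq] := limn_einf_Ny liou (- K) (maxn n0 1).
  have [q0 nq0] : (0 < q)%N /\ (n0 <= q)%N by move: nq; rewrite geq_max => /andP[].
  exists q; split=> //; split=> //.
  have qR : 0 < q%:R :> R by rewrite ltr0n.
  have aq : 0 < a ^+ q by apply: exprn_gt0; case/andP: a01.
  set eps := tnorm (pi_T2 v *+ q) in uq.
  have {}uq : K * q%:R < a ^+ q * - ln eps.
    by move: uq; rewrite lte_fin -mulrA mulrC ltr_pdivrMr //; lra.
  have lneg : ln eps < 0.
    have : 0 < a ^+ q * - ln eps by apply: lt_trans uq; exact: mulr_gt0.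
    by rewrite pmulr_rgt0 // oppr_gt0.
  have eps0 : 0 < eps.
    by rewrite ltNge; apply/negP => /ln0 E; move: lneg; rewrite E ltxx.
  have eps1 : eps < 1.
    by rewrite ltNge; apply/negP => /ln_ge0; rewrite leNgt lneg.
  have [p pZ pq] : exists2 p, p \in Z2 R & enorm (q%:R *: v - p) < 2 * eps.
    apply: tnorm_lt; have -> : pi_T2 (q%:R *: v) = pi_T2 v *+ q.
      rewrite scaler_nat; elim: (q) => [|k IH]; last by rewrite !mulrS pi_T2D IH.
      by rewrite !mulr0n -(subrr v) pi_T2B subrr.
    by rewrite -/eps; lra.
  have pq' : `|q%:R *: v - p| <= 2 * eps by exact: le_trans (enorm_ge _) (ltW pq).
  have eps01 : 0 < eps < 1 by rewrite eps0 eps1.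
  have disp := near_return_displacement a01 C0 d0 af hf lf eft rot irr devx A0 B0 HA q0 pZ eps01 pq' uq.
  apply: ge_sup; first by eexists; exists (pi_T2 0).
  move=> _ [z _ <-]; rewrite -(piK z) -(pi_iter _ _ lf) /tdist -pi_T2B.
  apply: le_trans (tnorm_le _ pZ) _; apply: le_trans (enorm_le _) _.
  by rewrite ler_pM2l // addrAC mulN1r; exact: disp.
have [pick pickP] := choice goods.
pose n_ := fix n_ j := if j is j'.+1 then pick (n_ j').+1 else pick 1%N.
have n_good j : good (n_ j).
  by case: j => [|j]; [exact: (pickP _).2|exact: (pickP _).2].
exists n_, 2, 1; split=> //.
- apply: homo_ltn => [|j]; first exact: ltn_trans.
  exact: (pickP (n_ j).+1).1.
- by move=> j; have [] := n_good j.
- by move=> j; have [] := n_good j.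
Qed.
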